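(* Let $d=1$, let $(U_n)_{n\ge 0}$ be the infinite color urn model associated with a random walk on $\mathbb{Z}$ with bounded i.i.d. increments $(X_j)_{j\ge1}$, where $X_1$ is not almost surely equal to $0$, and let $Z_n$ be the $(n+1)$-th selected color. Suppose $U_0=\delta_0$ (i.e. $U_{0,0}=1$ and $U_{0,v}=0$ for $v\ne 0$). Then for every $n\ge 1$, $$\sup_{x\in\mathbb{R}}\left|\mathbf{P}\left(\frac{Z_n-\mu h_n}{\sqrt{n\rho_2}}\le x\right)-\Phi(x)\right|\le 2.75\times\frac{\rho_3}{\sqrt{n}\,\rho_2^{3/2}},$$ and $$\frac{\rho_3}{\sqrt{n}\,\rho_2^{3/2}}=\mathcal{O}\left(\frac{1}{\sqrt{\log n}}\right)\quad\text{as } n\to\infty,$$ where $\Phi$ is the standard normal distribution function, $h_n:=\sum_{j=1}^n\frac{1}{j+1}$, $$\rho_2:=\frac1n\left(\sigma^2h_n-\mu^2\sum_{j=1}^n\frac{1}{(j+1)^2}\right),$$ $$\rho_3:=\frac1n\left(\sum_{j=1}^n\frac{1}{j+1}\mathbf{E}\left[\left|X_1-\frac{\mu}{j+1}\right|^3\right]+|\mu|^3\sum_{j=1}^n\frac{j}{(j+1)^4}\right).$$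
   Context: Let $(X_j)_{j\ge1}$ be i.i.d. random variables with values in $\mathbb{Z}$ and probability mass function $p(u):=\mathbf{P}(X_1=u)$; the increments are bounded, i.e. there is a finite nonempty $B\subseteq\mathbb{Z}$ with $p(u)=0$ for all $u\notin B$. Write $\mu:=\mathbf{E}[X_1]$ and $\sigma^2:=\mathbf{E}[X_1^2]$ (the second moment, not the centered variance). Infinite color urn model associated with the random walk: colors are indexed by $\mathbb{Z}$. Let $R$ be the transition matrix of the random walk with increments $(X_j)$, so that the $v$-th row $R_v$ of $R$ has $u$-th entry $p(u-v)$. The initial configuration $U_0=(U_{0,v})_{v\in\mathbb{Z}}$ is a probability distribution on $\mathbb{Z}$. Given $U_0,\dots,U_n$, a random color $Z_n$ (the $(n+1)$-th selected color) is chosen with $\mathbf{P}(Z_n=v\mid U_n,\dots,U_0)=U_{n,v}/(n+1)$, and then $U_{n+1}:=U_n+R_{Z_n}$. (Note $\sum_v U_{n,v}=n+1$.) *)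

(* Defs.v *)
From HB Require Import structures.
From mathcomp Require Import all_boot all_order all_algebra.
From mathcomp Require Import all_classical all_reals all_analysis.

Set Implicit Arguments.
Unset Strict Implicit.
Unset Printing Implicit Defensive.

Import Order.TTheory GRing.Theory Num.Theory.
Import numFieldNormedType.Exports.

Local Open Scope classical_set_scope.
Local Open Scope ring_scope.

(* [int] carries the discrete sigma-algebra, as [nat] does in the library. *)
HB.instance Definition _ := isPointed.Build int 0.
HB.instance Definition _ := @isMeasurable.Build default_measure_display
  int discrete_measurable discrete_measurable0
  discrete_measurableC discrete_measurableU.

Section independence.
Context d d' (T : measurableType d) (T' : measurableType d') (R : realType).
Variables (P : probability T R) (D : set nat) (X : nat -> {RV P >-> T'}).

Definition mutually_independent :=
  forall (J : seq nat) (A : nat -> set T'),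
    uniq J -> [set` J] `<=` D -> (forall j, measurable (A j)) ->
    P (\bigcap_(j in [set` J]) (X j @^-1` A j)) =
      (\prod_(j <- J) P (X j @^-1` A j))%E.

Definition identically_distributed :=
  forall i j (A : set T'), D i -> D j -> measurable A ->
    distribution P (X i) A = distribution P (X j) A.

(* The members of the family indexed by [D] are i.i.d. *)
Definition iid := mutually_independent /\ identically_distributed.

End independence.

Section increments.
Context d (T : measurableType d) (R : realType) (Q : probability T R).
Variable X1 : {RV Q >-> int}.

Definition incr_pmf (u : int) : R := fine (Q (X1 @^-1` [set u])).

Definition bounded_increment :=
  exists B : set int, [/\ finite_set B, B !=set0 &
    forall u, ~ B u -> incr_pmf u = 0].

Definition incr_mean : R := fine 'E_Q[fun w => (X1 w)%:~R].

(* The raw second moment, not the variance. *)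
Definition incr_moment2 : R := fine 'E_Q[fun w => (X1 w)%:~R ^+ 2].

Definition harm (n : nat) : R := \sum_(1 <= j < n.+1) j.+1%:R^-1.

Definition rho2 (n : nat) : R :=
  n%:R^-1 * (incr_moment2 * harm n
             - incr_mean ^+ 2 * \sum_(1 <= j < n.+1) (j.+1%:R ^+ 2)^-1).

Definition rho3 (n : nat) : R :=
  n%:R^-1 *
  (\sum_(1 <= j < n.+1)
      j.+1%:R^-1 * fine 'E_Q[fun w => `|(X1 w)%:~R - incr_mean / j.+1%:R| ^+ 3]
   + `|incr_mean| ^+ 3 * \sum_(1 <= j < n.+1) j%:R / j.+1%:R ^+ 4).

End increments.

Definition walk_matrix (R : realType) (p : int -> R) (v u : int) : R :=
  p (u - v).

Section urn.
Context d (T : measurableType d) (R : realType) (P : probability T R).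

(* [f] is a version of the conditional probability of the event [E] given the
   sigma-algebra [G]. *)
Definition cond_prob_version (G : set (set T)) (E : set T) (f : T -> R) :=
  [/\ forall B : set R, measurable B -> G (f @^-1` B),
      P.-integrable [set: T] (EFin \o f) &
      forall A, G A -> (\int[P]_(w in A) (f w)%:E)%E = P (A `&` E)].

(* The sigma-algebra generated by the configurations at times 0, ..., n. *)
Definition urn_history (U : nat -> int -> {RV P >-> R}) (n : nat)
    : set (set T) :=
  <<s \bigcup_(k in [set k | (k <= n)%N]) \bigcup_(v in [set: int])
        g_sigma_algebra_preimage (U k v) >>.

(* [U n v] is the weight of color [v] in the n-th configuration, [Z n] is the
   (n+1)-th selected color, and [M] is the replacement matrix. *)
Record infinite_urn (M : int -> int -> R) (U : nat -> int -> {RV P >-> R})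
    (Z : nat -> {RV P >-> int}) : Prop := {
  urn_init_ge0 : forall v w, 0 <= U 0%N v w;
  urn_init_sum1 : forall w, \esum_(v in [set: int]) (U 0%N v w)%:E = 1%E;
  urn_select : forall n v,
    cond_prob_version (urn_history U n) (Z n @^-1` [set v])
      (fun w => U n v w / n.+1%:R);
  urn_reinforce : forall n v w, U n.+1 v w = U n v w + M (Z n w) v }.

End urn.

Definition normal_cdf (R : realType) (x : R) : R :=
  fine (normal_prob (0 : R) 1 `]-oo, x]).

(* Main.v *)
Require Import Defs.
From HB Require Import structures.
From mathcomp Require Import all_boot all_order all_algebra.
From mathcomp Require Import all_classical all_reals all_analysis.
From mathcomp Require Import measurable_realfun complex ring lra.

(** The law pi_n of Z_n is explicit.  Averaging the selection rule shows that
      pi_{n+1} = ((n + 1) pi_n + pi_n * p) / (n + 2),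
    where * is the convolution with the increment law p.  Hence its characteristic
    function is the product over j = 1, ..., n of 1 - q_j + q_j psi(t), with
    q_j = 1 / (j + 1) and psi the characteristic function of p
    ([urn_prob], [urn_law_transform]).  So Z_n has the law of a sum of independent
    variables, the j-th being an increment kept with probability q_j and 0
    otherwise.  Their means add up to mu h_n, their variances to n rho_2 and their
    third absolute central moments to n rho_3; the first claim is then the
    Berry-Esseen theorem for non-identically distributed summands, with constant
    2.75 and Lyapunov fraction n rho_3 / (n rho_2)^{3/2}.

    That theorem ([berry_esseen]) is proved by Fourier analysis for finitely
    supported laws.  Smoothing by the Fejer kernel alone is too lossy for this
    constant, so the indicator of a half-line is instead trapped between the two
    extremal functions of Beurling, whose transforms are supported in [-1, 1]
    ([bfun_minorant], [bfun_majorant]).  The extremal property is obtained from the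
    monotonicity of these functions along y + 2 pi k and from the limit of their
    Cesaro means.  It yields a smoothing inequality ([smoothing]): the distance
    between the distribution functions is at most 0.41 times the integral over
    0 < t < T of |phi(t) - e^{- t^2 / 2}| / t, plus sqrt (2 pi) / T.  The difference
    of characteristic functions is estimated factor by factor ([chf_gauss_diff])
    and recombined by a telescoping product ([chf_prod_gauss]).

    For the second claim, n rho_2 is at least (sigma^2 / 2) h_n, because
    mu^2 <= sigma^2 and q_j <= 1/2, while n rho_3 is at most a constant times h_n
    as the increments are bounded.  The ratio is therefore at most of order
    1 / sqrt h_n, and h_n >= (ln n) / 3. *)

Set Implicit Arguments.
Unset Strict Implicit.
Unset Printing Implicit Defensive.

Import Order.TTheory GRing.Theory Num.Theory.
Import numFieldNormedType.Exports.

Local Open Scope classical_set_scope.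
Local Open Scope ring_scope.

(** * Taylor inequalities and numerical bounds *)

(** Differentiating a monomial in one step keeps instance search from unfolding
    the power into a product. *)
Lemma is_derive_monomial (R : realType) (c : R) n (x : R) :
  is_derive x 1 (fun y => c * y ^+ n.+1) (c * n.+1%:R * x ^+ n).
Proof.
have d := @is_deriveX R R id n.+1 x 1 1 (is_derive_id x 1).
have := is_deriveZ c d.
by rewrite /GRing.scale/= exprfctE mulr1 mulrA.
Qed.

#[export] Existing Instance is_derive_monomial | 0.

Section taylor.
Context {R : realType}.
Implicit Types (x y u : R) (f df : R -> R).

Lemma ge0_of_derive_itv f df b : 0 <= f 0 ->
  (forall x, is_derive x 1 f (df x)) ->
  (forall x, 0 <= x <= b -> 0 <= df x) -> forall x, 0 <= x <= b -> 0 <= f x.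
Proof.
move=> f0 fE df0 x /andP[x0 xb].
have cf : {within `[0, x], continuous f}.
  by apply: derivable_within_continuous => z _; have ? := fE z; exact: ex_derive.
have [c cx] := MVT_segment x0 (fun z _ => fE z) cf.
move: cx; rewrite in_itv/= subr0 => /andP[c0 cx] fxE.
have dfc : 0 <= df c by rewrite df0// c0 (le_trans cx).
by have := mulr_ge0 dfc x0; lra.
Qed.

Lemma ge0_of_derive f df : 0 <= f 0 ->
  (forall x, is_derive x 1 f (df x)) ->
  (forall x, 0 <= x -> 0 <= df x) -> forall x, 0 <= x -> 0 <= f x.
Proof.
move=> f0 fE df0 x x0.
apply: (@ge0_of_derive_itv f df x) => //; last by rewrite x0 lexx.
by move=> z /andP[z0 _]; exact: df0.
Qed.

Local Ltac der := apply: is_derive_eq; rewrite /GRing.scale/=; lra.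

Lemma sin_le_id x : 0 <= x -> sin x <= x.
Proof.
move=> x0; rewrite -subr_ge0.
apply: (@ge0_of_derive (fun x => x - sin x) (fun x => 1 - cos x)).
- by rewrite sin0 subrr.
- by move=> z _; rewrite subr_ge0 cos_le1.
- by [].
Qed.

Lemma cos_ge_taylor2 x : 1 - 2^-1 * x ^+ 2 <= cos x.
Proof.
wlog x0 : x / 0 <= x.
  move=> h; have [/h//|/ltW x0] := leP 0 x.
  by rewrite -sqrrN -cosN; apply: h; rewrite oppr_ge0.
rewrite -subr_ge0.
apply: (@ge0_of_derive (fun x => cos x - (1 - 2^-1 * x ^+ 2)) (fun x => x - sin x)).
- by rewrite cos0; lra.
- by move=> z; der.
- by move=> z z0; rewrite subr_ge0 sin_le_id.
- by [].
Qed.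

Lemma sin_ge_taylor3 x : 0 <= x -> x - 6^-1 * x ^+ 3 <= sin x.
Proof.
move=> x0; rewrite -subr_ge0.
apply: (@ge0_of_derive (fun x => sin x - (x - 6^-1 * x ^+ 3))
  (fun x => cos x - (1 - 2^-1 * x ^+ 2))).
- by rewrite sin0; lra.
- by move=> z; der.
- by move=> z z0; rewrite subr_ge0 cos_ge_taylor2.
- by [].
Qed.

Lemma cos_le_taylor4 x : 0 <= x -> cos x <= 1 - 2^-1 * x ^+ 2 + 24^-1 * x ^+ 4.
Proof.
move=> x0; rewrite -subr_ge0.
apply: (@ge0_of_derive (fun x => 1 - 2^-1 * x ^+ 2 + 24^-1 * x ^+ 4 - cos x)
  (fun x => sin x - (x - 6^-1 * x ^+ 3))).
- by rewrite cos0; lra.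
- by move=> z; der.
- by move=> z z0; rewrite subr_ge0 sin_ge_taylor3.
- by [].
Qed.

Lemma sin_le_taylor5 x : 0 <= x -> sin x <= x - 6^-1 * x ^+ 3 + 120^-1 * x ^+ 5.
Proof.
move=> x0; rewrite -subr_ge0.
apply: (@ge0_of_derive (fun x => x - 6^-1 * x ^+ 3 + 120^-1 * x ^+ 5 - sin x)
  (fun x => 1 - 2^-1 * x ^+ 2 + 24^-1 * x ^+ 4 - cos x)).
- by rewrite sin0; lra.
- by move=> z; der.
- by move=> z z0; rewrite subr_ge0 cos_le_taylor4.
- by [].
Qed.

Lemma cos_ge_taylor6 x : 0 <= x ->
  1 - 2^-1 * x ^+ 2 + 24^-1 * x ^+ 4 - 720^-1 * x ^+ 6 <= cos x.
Proof.
move=> x0; rewrite -subr_ge0.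
apply: (@ge0_of_derive (fun x => cos x - (1 - 2^-1 * x ^+ 2 + 24^-1 * x ^+ 4 - 720^-1 * x ^+ 6))
  (fun x => x - 6^-1 * x ^+ 3 + 120^-1 * x ^+ 5 - sin x)).
- by rewrite cos0; lra.
- by move=> z; der.
- by move=> z z0; rewrite subr_ge0 sin_le_taylor5.
- by [].
Qed.

Lemma sin_ge_taylor7 x : 0 <= x ->
  x - 6^-1 * x ^+ 3 + 120^-1 * x ^+ 5 - (720 * 7)^-1 * x ^+ 7 <= sin x.
Proof.
move=> x0; rewrite -subr_ge0.
apply: (@ge0_of_derive (fun x => sin x - (x - 6^-1 * x ^+ 3 + 120^-1 * x ^+ 5 - (720 * 7)^-1 * x ^+ 7))
  (fun x => cos x - (1 - 2^-1 * x ^+ 2 + 24^-1 * x ^+ 4 - 720^-1 * x ^+ 6))).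
- by rewrite sin0; lra.
- by move=> z; der.
- by move=> z z0; rewrite subr_ge0 cos_ge_taylor6.
- by [].
Qed.

Lemma cos_le_taylor8 x : 0 <= x ->
  cos x <= 1 - 2^-1 * x ^+ 2 + 24^-1 * x ^+ 4 - 720^-1 * x ^+ 6 + (720 * 56)^-1 * x ^+ 8.
Proof.
move=> x0; rewrite -subr_ge0.
apply: (@ge0_of_derive (fun x => 1 - 2^-1 * x ^+ 2 + 24^-1 * x ^+ 4 - 720^-1 * x ^+ 6 + (720 * 56)^-1 * x ^+ 8 - cos x)
  (fun x => sin x - (x - 6^-1 * x ^+ 3 + 120^-1 * x ^+ 5 - (720 * 7)^-1 * x ^+ 7))).
- by rewrite cos0; lra.
- by move=> z; der.
- by move=> z z0; rewrite subr_ge0 sin_ge_taylor7.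
- by [].
Qed.

(** For |x| >= 4.6 the right-hand side exceeds 1.  Below 4.6 the eighth-order
    Taylor bound reduces the claim to the positivity of a quintic.  The optimal
    constant is about 0.0992; the modulus bound [normc_chf_le] has room for
    11/100. *)
Lemma cos_le_cubic x : cos x <= 1 - 2^-1 * x ^+ 2 + 11 / 100 * `|x| ^+ 3.
Proof.
wlog x0 : x / 0 <= x.
  move=> h; have [/h//|/ltW x0] := leP 0 x.
  by rewrite -sqrrN -cosN -normrN; apply: h; rewrite oppr_ge0.
rewrite ger0_norm//.
have [x46|/ltW x46] := leP x (46 / 10); last first.
  apply: (le_trans (cos_le1 x)).
  have : 0 <= x ^+ 2 * (11 / 100 * x - 1 / 2) by apply: mulr_ge0; [exact: sqr_ge0|lra].
  by lra.
apply: (le_trans (cos_le_taylor8 x0)).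
have h : 0 <= 11 / 100 - x / 24 + x ^+ 3 / 720 - x ^+ 5 / (720 * 56).
  (* the quintic is positive at 4.6, and q is its divided difference between x and 4.6 *)
  have q : 0 <= 24^-1 - ((46 / 10) ^+ 2 + 46 / 10 * x + x ^+ 2) / 720
    + ((46 / 10) ^+ 4 + (46 / 10) ^+ 3 * x + (46 / 10) ^+ 2 * x ^+ 2
       + 46 / 10 * x ^+ 3 + x ^+ 4) / (720 * 56).
    by have := sqr_ge0 (x ^+ 2 + 23 / 10 * x - 201 / 10); have := sqr_ge0 x; lra.
  have x46' : 0 <= 46 / 10 - x by lra.
  by have := mulr_ge0 x46' q; lra.
have : 0 <= x ^+ 3 * (11 / 100 - x / 24 + x ^+ 3 / 720 - x ^+ 5 / (720 * 56)).
  by apply: mulr_ge0 => //; exact: exprn_ge0.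
by lra.
Qed.

(** The left-hand side is the squared modulus of e^{ix} - 1 - ix + x^2/2.  The
    difference of the two sides vanishes at 0 and has derivative
    x^2 (sin x - x + x^3/6) >= 0. *)
Lemma taylor2_expi x :
  (cos x - 1 + 2^-1 * x ^+ 2) ^+ 2 + (sin x - x) ^+ 2 <= (6^-1 * `|x| ^+ 3) ^+ 2.
Proof.
wlog x0 : x / 0 <= x.
  move=> h; have [/h//|/ltW x0] := leP 0 x.
  have := h (- x); rewrite oppr_ge0 => /(_ x0).
  rewrite cosN sinN normrN [(- x) ^+ 2]sqrrN.
  by rewrite (_ : - sin x - - x = - (sin x - x)) ?sqrrN//; lra.
rewrite ger0_norm// -subr_ge0.
apply: (@ge0_of_derive (fun x => (6^-1 * x ^+ 3) ^+ 2 - ((cos x - 1 + 2^-1 * x ^+ 2) ^+ 2 + (sin x - x) ^+ 2))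
  (fun x => x ^+ 2 * (sin x - (x - 6^-1 * x ^+ 3)))).
- by rewrite cos0 sin0; lra.
- by move=> z; apply: is_derive_eq; rewrite /GRing.scale/=; field.
- by move=> z z0; rewrite mulr_ge0// ?sqr_ge0// subr_ge0 sin_ge_taylor3.
- by [].
Qed.

Lemma expR_ge_taylor2 x : 0 <= x -> 1 + x + 2^-1 * x ^+ 2 <= expR x.
Proof.
move=> x0; rewrite -subr_ge0.
apply: (@ge0_of_derive (fun x => expR x - (1 + x + 2^-1 * x ^+ 2)) (fun x => expR x - (1 + x))).
- by rewrite expR0; lra.
- by move=> z; der.
- by move=> z z0; rewrite subr_ge0 expR_ge1Dx.
- by [].
Qed.

(** From e^{-y} <= 1 / (1 + y + y^2/2) at y = u^2/2.  Putting u^3 rather than u^4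
    in the error lets it be absorbed in the third absolute moment by Lyapunov's
    inequality. *)
Lemma expRN_sqr_half u : 0 <= u ->
  expR (- (u ^+ 2 / 2)) <= 1 - u ^+ 2 / 2 + 155 / 1000 * u ^+ 3.
Proof.
move=> u0; rewrite expRN.
have y0 : 0 <= u ^+ 2 / 2 by rewrite divr_ge0// sqr_ge0.
have e := expR_ge_taylor2 y0.
have p0 : 0 < 1 + u ^+ 2 / 2 + (u ^+ 2 / 2) ^+ 2 / 2.
  by have := sqr_ge0 (u ^+ 2 / 2); lra.
apply: (@le_trans _ _ (1 + u ^+ 2 / 2 + (u ^+ 2 / 2) ^+ 2 / 2)^-1).
  by rewrite lef_pV2 ?posrE ?expR_gt0//; lra.
rewrite -div1r ler_pdivrMr//.
have q : 0 <= 155 / 1000 - u / 8 + 31 / 400 * u ^+ 2 - u ^+ 3 / 16 + 31 / 1600 * u ^+ 4.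
  have := sqr_ge0 (u ^+ 2 - 1613 / 1000 * u - 3 / 10).
  have := sqr_ge0 (u - 186 / 100).
  by have := sqr_ge0 (u); lra.
by have := mulr_ge0 (exprn_ge0 3 u0) q; lra.
Qed.

Lemma expRN_le_taylor2 x : 0 <= x -> expR (- x) <= 1 - x + 2^-1 * x ^+ 2.
Proof.
move=> x0; rewrite -subr_ge0.
apply: (@ge0_of_derive (fun x => 1 - x + 2^-1 * x ^+ 2 - expR (- x))
  (fun x => expR (- x) - (1 - x))).
- by rewrite oppr0 expR0; lra.
- by move=> z; der.
- by move=> z z0; rewrite subr_ge0 expR_ge1Dx.
- by [].
Qed.

Lemma expRN_ge_taylor3 x : 0 <= x ->
  1 - x + 2^-1 * x ^+ 2 - 6^-1 * x ^+ 3 <= expR (- x).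
Proof.
move=> x0; rewrite -subr_ge0.
apply: (@ge0_of_derive (fun x => expR (- x) - (1 - x + 2^-1 * x ^+ 2 - 6^-1 * x ^+ 3))
  (fun x => 1 - x + 2^-1 * x ^+ 2 - expR (- x))).
- by rewrite oppr0 expR0; lra.
- by move=> z; der.
- by move=> z z0; rewrite subr_ge0 expRN_le_taylor2.
- by [].
Qed.

(** A Taylor estimate of a characteristic function carries no Gaussian decay;
    this bound is the price, 1.47, for putting the decay back.  The exponent is
    largest at u = 50/33. *)
Lemma expR_removal u : 0 <= u -> expR (u ^+ 2 / 2 - 22 / 100 * u ^+ 3) <= 147 / 100.
Proof.
move=> u0.
have h : u ^+ 2 / 2 - 22 / 100 * u ^+ 3 <= 3827 / (100 * 100).
  (* the gap to the maximum is 0.22 (u - 50/33)^2 (u + 25/33) *)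
  have u0' : 0 <= u + 25 / 33 by lra.
  by have := mulr_ge0 (sqr_ge0 (u - 50 / 33)) u0'; lra.
apply: (le_trans (_ : _ <= expR (3827 / (100 * 100)))); first by rewrite ler_expR.
rewrite -[X in expR X]opprK expRN -[leRHS]invrK lef_pV2 ?posrE ?expR_gt0//.
have y0 : (0 : R) <= 3827 / (100 * 100) by lra.
by apply: le_trans (expRN_ge_taylor3 y0); lra.
Qed.

(** The sixth-order Taylor bound makes cos 1.55 positive, so 1.55 lies below
    pi / 2. *)
Lemma pi_ge31 : (31 / 10 : R) <= pi.
Proof.
rewrite leNgt; apply/negP => pi31.
have := cos_pihalf R; have p0 := pi_gt0 R; have p2 := pi_ge2 R.
have y0 : (0 : R) <= 155 / 100 by lra.
have : cos (155 / 100) < cos (pi / 2 : R).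
  by rewrite ltr_cos ?in_itv/=; lra.
by have := cos_ge_taylor6 y0; lra.
Qed.

Lemma pi_le317 : pi <= (317 / 100 : R).
Proof.
rewrite leNgt; apply/negP => pi31.
have := cos_pihalf R; have p0 := pi_gt0 R; have p2 := pi_ge2 R.
have y0 : (0 : R) <= 1585 / 1000 by lra.
have : cos (pi / 2 : R) < cos (1585 / 1000).
  by rewrite ltr_cos ?in_itv/=; lra.
by have := cos_le_taylor8 y0; lra.
Qed.

End taylor.

(** * Integrals over the unit interval *)

Section integrable_real.
Context d (T : measurableType d) (R : realType).
Variables (mu : {measure set T -> \bar R}) (D : set T).
Hypothesis mD : measurable D.
Implicit Types f g : T -> R.

Lemma integrable_realD f g : mu.-integrable D (EFin \o f) ->
  mu.-integrable D (EFin \o g) ->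
  mu.-integrable D (EFin \o (fun t => f t + g t)).
Proof. by move=> fi gi; have := integrableD mD fi gi. Qed.

Lemma integrable_realB f g : mu.-integrable D (EFin \o f) ->
  mu.-integrable D (EFin \o g) ->
  mu.-integrable D (EFin \o (fun t => f t - g t)).
Proof. by move=> fi gi; have := integrableB mD fi gi. Qed.

Lemma integrable_realZ f k : mu.-integrable D (EFin \o f) ->
  mu.-integrable D (EFin \o (fun t => k * f t)).
Proof. by move=> fi; have := integrableZl mD k fi. Qed.

End integrable_real.

Section unit_interval.
Context {R : realType}.
Notation mu := (@lebesgue_measure R).
Implicit Types (f F : R -> R) (t x y : R).

Lemma integrable_bounded01 f (M : R) : measurable_fun (`]0, 1[%classic : set R) f ->
  (forall t, 0 < t < 1 -> `|f t| <= M) -> mu.-integrable `]0, 1[ (EFin \o f).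
Proof.
move=> mf fM; apply: measurable_bounded_integrable => //.
  by rewrite /= lebesgue_measure_itv/= lte_fin ltr01 oppr0 adde0 ltry.
exists M; split; first exact: num_real.
move=> N MN t; rewrite /= in_itv/= => t01.
exact: le_trans (fM t t01) (ltW MN).
Qed.

Lemma integrable_continuous01 f : continuous f ->
  mu.-integrable `]0, 1[ (EFin \o f).
Proof.
move=> cf; apply: (@integrableS _ _ _ mu `[0%R, 1%R]%classic) => //.
  exact: subset_itv_oo_cc.
apply: continuous_compact_integrable; first exact: segment_compact.
exact: continuous_subspaceT.
Qed.

Lemma Rintegral01_derive F f : (forall x, is_derive x 1 F (f x)) ->
  continuous f -> \int[mu]_(t in `]0, 1[) f t = F 1 - F 0.
Proof.
move=> FE cf.
have intf : mu.-integrable `[0, 1] (EFin \o f).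
  apply: continuous_compact_integrable; first exact: segment_compact.
  exact: continuous_subspaceT.
have cF : continuous F.
  by move=> x; apply/differentiable_continuous/derivable1_diffP; have ? := FE x; exact: ex_derive.
rewrite Rintegral_itv_bndo_bndc; last first.
  by apply: integrableS intf => //; exact: subset_itv_oo_cc.
rewrite Rintegral_itv_obnd_cbnd; last first.
  by apply: integrableS intf => //; exact: subset_itv_oc_cc.
rewrite /Rintegral (@continuous_FTC2 _ f F)//.
- exact: continuous_subspaceT.
- split.
  + by move=> x _; have ? := FE x; exact: ex_derive.
  + by apply: cvg_at_right_filter; exact: cF.
  + by apply: cvg_at_left_filter; exact: cF.
- by move=> x _; rewrite derive1E; have ? := FE x; rewrite derive_val.
Qed.

Lemma Rintegral01_sin y : y * \int[mu]_(t in `]0, 1[) sin (t * y) = 1 - cos y.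
Proof.
rewrite -RintegralZl//; last first.
  apply: (@integrable_bounded01 _ 1) => [|t _]; last exact: sin_max.
  apply: measurable_funTS; apply: measurable_realfun.continuous_measurable_fun => t.
  by apply: continuous_comp; [exact: mulrr_continuous|exact: continuous_sin].
have FE t : is_derive t 1 (fun t => - cos (t * y)) (y * sin (t * y)).
  by apply: is_derive_eq; rewrite /GRing.scale/=; lra.
rewrite (Rintegral01_derive FE).
- by rewrite mul1r mul0r cos0; lra.
- move=> t; apply: cvgM; first exact: cvg_cst.
  by apply: continuous_comp; [exact: mulrr_continuous|exact: continuous_sin].
Qed.

Lemma Rintegral01_fejer y :
  y ^+ 2 * \int[mu]_(t in `]0, 1[) ((1 - t) * cos (t * y)) = 1 - cos y.
Proof.
have c1 : continuous (fun t : R => (1 - t) * cos (t * y)).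
  move=> t; apply: cvgM.
    by apply: cvgB; [exact: cvg_cst|exact: cvg_id].
  by apply: continuous_comp; [exact: mulrr_continuous|exact: continuous_cos].
rewrite -RintegralZl//; last exact: integrable_continuous01.
have FE t : is_derive t 1 (fun t => y * (1 - t) * sin (t * y) - cos (t * y))
    (y ^+ 2 * ((1 - t) * cos (t * y))).
  by apply: is_derive_eq; rewrite /GRing.scale/=; lra.
rewrite (Rintegral01_derive FE).
- by rewrite mul1r mul0r cos0 sin0; lra.
- by move=> t; apply: cvgM; [exact: cvg_cst|exact: c1].
Qed.

End unit_interval.

(** * Beurling's majorant of the sign function *)

Section beurling.
Context {R : realType}.
Notation mu := (@lebesgue_measure R).
Implicit Types (t x y : R).

(** The odd function [bfun] and the even function [fejer] below have Fourier
    transforms carried by [-1, 1], with densities [bweight] and 2 (1 - t) on ]0, 1[.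
    At y = 2 pi x, [bfun] is Beurling's function H(x) and [fejer] is
    (sin (pi x) / (pi x))^2. *)
Definition bweight t : R := 2 * (1 - t) * cos (pi * t) / sin (pi * t) + 2 / pi.

Definition bfun y : R := \int[mu]_(t in `]0, 1[) (bweight t * sin (t * y)).

Definition fejer y : R := 2 * \int[mu]_(t in `]0, 1[) ((1 - t) * cos (t * y)).

Lemma mul_cos_le_sin (s : R) : 0 <= s <= pi -> s * cos s <= sin s.
Proof.
move=> sI; rewrite -subr_ge0.
apply: (@ge0_of_derive_itv _ (fun s : R => sin s - s * cos s) (fun s : R => s * sin s) pi) => //.
- by rewrite sin0; lra.
- by move=> z; apply: is_derive_eq; rewrite /GRing.scale/=; lra.
- by move=> z zI; rewrite mulr_ge0 ?sin_ge0_pi//; case/andP : zI.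
Qed.

Lemma sin_pi_gt0 t : 0 < t < 1 -> 0 < sin (pi * t).
Proof.
move=> /andP[t0 t1]; apply: sin_gt0_pi; rewrite mulr_gt0 ?pi_gt0//=.
by rewrite gtr_pMr ?pi_gt0.
Qed.

(** The weight is 2 / pi times (pi (1 - t) cot (pi t) + 1); bounding the cotangent
    on both sides is the inequality s cos s <= sin s at s = pi t and at
    s = pi (1 - t).  The upper bound makes [bweight t * sin (t * y)] bounded in
    spite of the pole of the cotangent at 0. *)
Lemma bweight_bounds t : 0 < t < 1 -> 0 <= bweight t <= 2 / (pi * t).
Proof.
move=> t01; have s0 := sin_pi_gt0 t01; have p0 := pi_gt0 R.
move: t01 => /andP[t0 t1].
have h1 : pi * t * cos (pi * t) <= sin (pi * t).
  by apply: mul_cos_le_sin; rewrite mulr_ge0 ?ler_piMr ?ltW.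
have h2 : - (pi * (1 - t) * cos (pi * t)) <= sin (pi * t).
  have : pi * (1 - t) * cos (pi * (1 - t)) <= sin (pi * (1 - t)).
    have t1' : 0 < 1 - t by lra.
    by apply: mul_cos_le_sin; rewrite mulr_ge0 ?ler_piMr ?ltW//; lra.
  rewrite mulrBr mulr1 cosB sinB cospi sinpi; lra.
have -> : bweight t = 2 * (pi * (1 - t) * cos (pi * t) + sin (pi * t)) / (pi * sin (pi * t)).
  rewrite /bweight; have := lt0r_neq0 s0; have := lt0r_neq0 p0.
  by move: (cos (pi * t)) (sin (pi * t)) (@pi R) => c s p p_neq0 s_neq0; field; apply/andP.
have ps0 : 0 < pi * sin (pi * t) by exact: mulr_gt0.
apply/andP; split; first by rewrite divr_ge0 ?(ltW ps0)//; lra.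
rewrite ler_pdivrMr// [leRHS]mulrAC ler_pdivlMr ?mulr_gt0//.
have : t * (pi * (1 - t) * cos (pi * t)) <= (1 - t) * sin (pi * t).
  rewrite (_ : t * _ = (1 - t) * (pi * t * cos (pi * t))); last by ring.
  by rewrite ler_wpM2l//; lra.
move=> h3; have := ler_wpM2l (ltW p0) h3; lra.
Qed.

Lemma norm_sin_le x : `|sin x| <= `|x|.
Proof.
wlog x0 : x / 0 <= x.
  move=> h; have [/h//|/ltW x0] := leP 0 x.
  by rewrite -normrN -sinN -[leRHS]normrN; apply: h; rewrite oppr_ge0.
rewrite [leRHS]ger0_norm// ler_norml sin_le_id// andbT lerNl -sinN.
have [xpi|xpi] := leP x pi.
  by rewrite sinN (@le_trans _ _ 0)// oppr_le0 sin_ge0_pi// x0.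
by rewrite (le_trans (sin_le1 _))// (le_trans _ (ltW xpi))// (le_trans _ (pi_ge2 R))// ler1n.
Qed.

Lemma measurable_bweight : measurable_fun (`]0, 1[%classic : set R) bweight.
Proof.
apply: measurable_realfun.open_continuous_measurable_fun => //.
move=> t; rewrite inE/= in_itv/= => t01.
have cpi : {for t, continuous (fun t : R => pi * t)} by exact: mulrl_continuous.
rewrite /bweight; apply: cvgD; last exact: cvg_cst.
apply: cvgM; last first.
  apply: cvgV; first by rewrite gt_eqF// sin_pi_gt0.
  have : {for t, continuous (sin \o (fun t : R => pi * t))} by apply: continuous_comp => //; exact: continuous_sin.
  exact.
apply: cvgM; last first.
  have : {for t, continuous (cos \o (fun t : R => pi * t))} by apply: continuous_comp => //; exact: continuous_cos.
  exact.
by apply: cvgM; [exact: cvg_cst|apply: cvgB; [exact: cvg_cst|exact: cvg_id]].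
Qed.

Lemma continuous_sinM y : continuous (fun t : R => sin (t * y)).
Proof.
by move=> t; apply: continuous_comp; [exact: mulrr_continuous|exact: continuous_sin].
Qed.

Lemma continuous_cosM y : continuous (fun t : R => cos (t * y)).
Proof.
by move=> t; apply: continuous_comp; [exact: mulrr_continuous|exact: continuous_cos].
Qed.

Lemma continuous_fejerM y : continuous (fun t : R => (1 - t) * cos (t * y)).
Proof.
move=> t; apply: cvgM; last exact: continuous_cosM.
by apply: cvgB; [exact: cvg_cst|exact: cvg_id].
Qed.

Lemma bweightM_bounded (f M : R) t : 0 < t < 1 -> `|f| <= t * M ->
  `|bweight t * f| <= 2 / pi * M.
Proof.
move=> t01 fM; have /andP[b0 b1] := bweight_bounds t01.
rewrite normrM ger0_norm//; move: t01 => /andP[t0 _].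
apply: (le_trans (ler_pM b0 (normr_ge0 _) b1 fM)).
rewrite le_eqVlt; apply/orP; left; apply/eqP.
have := lt0r_neq0 (pi_gt0 R); have := lt0r_neq0 t0.
by move: (@pi R) => p t_neq0 p_neq0; field; apply/andP.
Qed.

Lemma norm_sinM_le t y : 0 < t -> `|sin (t * y)| <= t * `|y|.
Proof. by move=> t0; rewrite -{2}(gtr0_norm t0) -normrM; exact: norm_sin_le. Qed.

Lemma integrable_bfun y :
  mu.-integrable `]0, 1[ (EFin \o (fun t => bweight t * sin (t * y))).
Proof.
apply: (@integrable_bounded01 _ _ (2 / pi * `|y|)).
  apply: measurable_funM; first exact: measurable_bweight.
  by apply: measurable_funTS; apply: measurable_realfun.continuous_measurable_fun; exact: continuous_sinM.
move=> t /[dup] t01 /andP[t0 _]; apply: bweightM_bounded => //.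
exact: norm_sinM_le.
Qed.

Lemma bfunN y : bfun (- y) = - bfun y.
Proof.
rewrite /bfun -[RHS]mulN1r -RintegralZl//; last exact: integrable_bfun.
by apply: eq_Rintegral => t _; rewrite mulrN sinN; ring.
Qed.

Lemma bfun0 : bfun 0 = 0.
Proof. by have := bfunN 0; rewrite oppr0; lra. Qed.

Lemma fejerN y : fejer (- y) = fejer y.
Proof.
by rewrite /fejer; congr (_ * _); apply: eq_Rintegral => t _; rewrite mulrN cosN.
Qed.

Lemma fejerE y : y != 0 -> fejer y = 2 * (1 - cos y) / y ^+ 2.
Proof.
by move=> y0; rewrite -Rintegral01_fejer /fejer; field; rewrite y0.
Qed.

Lemma fejer0 : fejer 0 = 1.
Proof.
have FE t : is_derive t 1 (fun t : R => t - 2^-1 * t ^+ 2) ((1 - t) * cos (t * 0)).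
  by apply: is_derive_eq; rewrite /GRing.scale/= mulr0 cos0; lra.
by rewrite /fejer (Rintegral01_derive FE); [lra|exact: continuous_fejerM].
Qed.

Lemma fejer_ge0 y : 0 <= fejer y.
Proof.
have [->|y0] := eqVneq y 0; first by rewrite fejer0.
by rewrite fejerE// divr_ge0// ?sqr_ge0// mulr_ge0// subr_ge0 cos_le1.
Qed.

Let S y : R := \int[mu]_(t in `]0, 1[) sin (t * y).

(** In sin (t y + 2 pi t) - sin (t y) = 2 cos (t y + pi t) sin (pi t) the factor
    sin (pi t) cancels the cotangent, so the increment of [bfun] over a period is
    an elementary integral. *)
Lemma bfunD2pi y : bfun (y + 2 * pi) =
  bfun y + (fejer y + fejer (y + 2 * pi)) + 2 / pi * (S (y + 2 * pi) - S y).
Proof.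
have p0 := pi_gt0 R.
have iS z : mu.-integrable `]0, 1[ (EFin \o (fun t : R => sin (t * z))).
  by apply: integrable_continuous01; exact: continuous_sinM.
have iK z : mu.-integrable `]0, 1[ (EFin \o (fun t : R => (1 - t) * cos (t * z))).
  by apply: integrable_continuous01; exact: continuous_fejerM.
apply/eqP; rewrite -addrA [bfun y + _]addrC -subr_eq; apply/eqP.
rewrite /bfun -RintegralB//; try exact: integrable_bfun.
rewrite /fejer -mulrDr -RintegralD// -RintegralB//.
rewrite -[in X in _ = X + _]RintegralZl//; last exact: integrable_realD.
rewrite -[in X in _ = _ + X]RintegralZl//; last exact: integrable_realB.
rewrite -RintegralD//=; last 2 first.
  by apply: integrable_realZ => //; exact: integrable_realD.
  by apply: integrable_realZ => //; exact: integrable_realB.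
apply: eq_Rintegral => t; rewrite inE/= in_itv/= => t01.
have s0 : sin (pi * t) != 0 by rewrite gt_eqF// sin_pi_gt0.
have -> : t * (y + 2 * pi) = (t * y + pi * t) + pi * t by ring.
have : t * y = (t * y + pi * t) - pi * t by ring.
move: (t * y + pi * t) => a ->; rewrite /bweight sinB cosB sinD cosD.
have := lt0r_neq0 p0; move: s0.
by move: (sin (pi * t)) (cos (pi * t)) (@pi R) => s c p s0 pn0; field; apply/andP.
Qed.

(** Both monotonicity properties of the extremal function along y + 2 pi k are
    read off this closed form of the increment. *)
Lemma bfun_step y : 0 < y -> bfun (y + 2 * pi) =
  bfun y + 2 * (1 - cos y) * (y^-1 - (y + 2 * pi)^-1) ^+ 2.
Proof.
move=> y0; have p0 := pi_gt0 R.
have y1 : 0 < y + 2 * pi by lra.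
have cE : cos (y + 2 * pi) = cos y by rewrite mulrC mulr_natr cosD2pi.
rewrite bfunD2pi !fejerE ?lt0r_neq0// cE.
have -> : S y = (1 - cos y) / y.
  by rewrite -Rintegral01_sin -/(S _) mulrAC divff ?mul1r// lt0r_neq0.
have -> : S (y + 2 * pi) = (1 - cos y) / (y + 2 * pi).
  by rewrite -cE -Rintegral01_sin -/(S _) mulrAC divff ?mul1r// lt0r_neq0.
have := lt0r_neq0 p0; have := lt0r_neq0 y0; have := lt0r_neq0 y1.
move: (cos y) (@pi R) => c p y1n yn pn; field.
by rewrite pn y1n yn.
Qed.

Lemma bfun_incr y : 0 < y -> bfun y <= bfun (y + 2 * pi).
Proof.
by move=> y0; rewrite bfun_step// lerDl mulr_ge0 ?sqr_ge0//.
Qed.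

Lemma bfun_fejer_decr y : 0 < y ->
  bfun (y + 2 * pi) + fejer (y + 2 * pi) <= bfun y + fejer y.
Proof.
move=> y0; have p0 := pi_gt0 R.
have y1 : 0 < y + 2 * pi by lra.
have cE : cos (y + 2 * pi) = cos y by rewrite mulrC mulr_natr cosD2pi.
rewrite bfun_step// !fejerE ?lt0r_neq0// cE.
have yV : (y + 2 * pi)^-1 <= y^-1 by rewrite lef_pV2 ?posrE//; lra.
have zV : 0 < (y + 2 * pi)^-1 by rewrite invr_gt0.
have c0 : 0 <= 1 - cos y by rewrite subr_ge0 cos_le1.
rewrite -!exprVn; move: (y^-1) ((y + 2 * pi)^-1) yV zV => a b ba b0.
have := mulr_ge0 c0 (mulr_ge0 (ltW b0) (_ : 0 <= a - b)).
by rewrite subr_ge0 => /(_ ba); lra.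
Qed.

Lemma bfun_2pi n : bfun (n.+1%:R * (2 * pi)) = 1.
Proof.
have p0 := pi_gt0 R.
elim: n => [|n IHn].
  have := bfunD2pi 0; rewrite add0r mul1r bfun0 fejer0 fejerE; last by rewrite lt0r_neq0//; lra.
  have c1 : cos (2 * pi) = 1 :> R by rewrite mulrC mulr_natr cos2pi.
  have := Rintegral01_sin (2 * pi : R); rewrite -/(S _) c1 subrr => /eqP.
  rewrite mulf_eq0 gt_eqF/=; last by lra.
  move=> /eqP ->.
  have -> : S 0 = 0.
    rewrite /S; under eq_Rintegral do rewrite mulr0 sin0.
    by rewrite Rintegral_cst// mul0r.
  by move=> ->; lra.
have -> : n.+2%:R * (2 * pi) = n.+1%:R * (2 * pi) + 2 * pi :> R.
  by rewrite -addn1 natrD mulrDl mul1r.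
rewrite bfun_step; last by rewrite mulr_gt0//; lra.
rewrite IHn (_ : cos _ = 1); first by rewrite subrr mulr0 mul0r addr0.
rewrite [2 * _]mulrC !mulr_natr mulr_natl -[_ *+ n.+1]add0r.
by rewrite (periodicn (@cosD2pi R)) cos0.
Qed.

Let sinsum y n t : R := \sum_(k < n) sin (t * (y + k.+1%:R * (2 * pi))).

Let bweight_sinsumS y n : (fun t => bweight t * sinsum y n.+1 t) =
  (fun t => bweight t * sinsum y n t + bweight t * sin (t * (y + n.+1%:R * (2 * pi)))).
Proof. by apply/funext => t; rewrite /sinsum big_ord_recr/= mulrDr. Qed.

Let integrable_sinsum y n :
  mu.-integrable `]0, 1[ (EFin \o (fun t => bweight t * sinsum y n t)).
Proof.
elim: n => [|n IHn].
  rewrite (_ : _ \o _ = cst 0%E); first exact: integrable0.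
  by apply/funext => t; rewrite /sinsum /= big_ord0 mulr0.
rewrite bweight_sinsumS; apply: integrable_realD => //; exact: integrable_bfun.
Qed.

Let sum_bfun y n : \int[mu]_(t in `]0, 1[) (bweight t * sinsum y n t)
  = \sum_(k < n) bfun (y + k.+1%:R * (2 * pi)).
Proof.
elim: n => [|n IHn].
  rewrite big_ord0; under eq_Rintegral do rewrite /sinsum big_ord0 mulr0.
  by rewrite Rintegral_cst// mul0r.
rewrite bweight_sinsumS RintegralD//; last exact: integrable_bfun.
by rewrite IHn big_ord_recr.
Qed.

Lemma sin_mul_sum_cos (a b : R) n :
  2 * sin b * \sum_(k < n) cos (a + k%:R * (2 * b)) =
  sin (a + n%:R * (2 * b) - b) - sin (a - b).
Proof.
elim: n => [|n IHn]; first by rewrite big_ord0 mulr0 mul0r addr0 subrr.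
rewrite big_ord_recr/= mulrDr IHn.
have -> : a + n.+1%:R * (2 * b) - b = (a + n%:R * (2 * b)) + b.
  by rewrite -addn1 natrD; ring.
by rewrite !sinB !sinD !cosD; ring.
Qed.

Let dirichlet y n t : R :=
  n.+1%:R^-1 * \sum_(k < n.+1) cos (t * y / 2 + 2 * pi * t + k%:R * (2 * (pi * t))).

Let dirichlet_le1 y n t : `|dirichlet y n t| <= 1.
Proof.
rewrite /dirichlet normrM ger0_norm ?invr_ge0// ler_pdivrMl// mulr1.
apply: (le_trans (ler_norm_sum _ _ _)).
rewrite (le_trans (ler_sum _ (fun k _ => cos_max _)))//.
by rewrite sumr_const card_ord.
Qed.

Let dirichlet_le y n t : 0 < t < 1 ->
  `|dirichlet y n t| <= n.+1%:R^-1 * (sin (pi * t))^-1.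
Proof.
move=> t01; have s0 := sin_pi_gt0 t01.
rewrite /dirichlet normrM [X in X * _]ger0_norm ?invr_ge0//.
rewrite ler_wpM2l ?invr_ge0// -[leRHS]mul1r ler_pdivlMr//.
have h (a b : R) : `|sin a - sin b| <= 2.
  by apply: (le_trans (ler_normB _ _)); have := sin_max a; have := sin_max b; lra.
have := h (t * y / 2 + 2 * pi * t + n.+1%:R * (2 * (pi * t)) - pi * t)
          (t * y / 2 + 2 * pi * t - pi * t).
rewrite -sin_mul_sum_cos !normrM (gtr0_norm s0) [X in X * _ * _]ger0_norm//.
by lra.
Qed.

Let cvg_dirichlet y t : 0 < t < 1 -> dirichlet y n t @[n --> \oo] --> 0.
Proof.
move=> t01; apply/norm_cvg0P.
apply: (@squeeze_cvgr _ _ _ _ (fun=> 0) (fun n => n.+1%:R^-1 * (sin (pi * t))^-1)).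
- by apply: nearW => n; rewrite normr_ge0 dirichlet_le.
- exact: cvg_cst.
- rewrite -[X in _ --> X](mul0r (sin (pi * t))^-1); apply: cvgM; last exact: cvg_cst.
  exact: cvg_harmonic.
Qed.

(** The limit is 1 when y = 0, since [bfun] equals 1 at the positive multiples of
    2 pi.  The difference between the means at y and at 0 integrates an averaged
    Dirichlet kernel, which is bounded by 1 and tends to 0 at each t in ]0, 1[, so
    dominated convergence gives the same limit for all y. *)
Lemma cvg_bfun_cesaro y :
  n.+1%:R^-1 * \sum_(k < n.+1) bfun (y + k.+1%:R * (2 * pi)) @[n --> \oo] --> (1 : R).
Proof.
have E n : n.+1%:R^-1 * (\sum_(k < n.+1) bfun (y + k.+1%:R * (2 * pi))) =
   1 + \int[mu]_(t in `]0, 1[) (bweight t * (2 * sin (t * y / 2)) * dirichlet y n t).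
  have S0 : n.+1%:R^-1 * (\sum_(k < n.+1) bfun (0 + k.+1%:R * (2 * pi))) = 1.
    under eq_bigr do rewrite add0r bfun_2pi.
    by rewrite sumr_const card_ord mulVf.
  apply/eqP; rewrite [eqbRHS]addrC -subr_eq -[X in _ - X]S0 -!sum_bfun -!RintegralZl//.
  rewrite -RintegralB//; do ?exact: integrable_realZ.
  apply/eqP; apply: eq_Rintegral => t _.
  rewrite -!mulrBr /dirichlet mulrCA -[RHS]mulrA; congr (_ * _).
  rewrite [RHS]mulrCA; congr (_ * _).
  rewrite -sumrB mulr_sumr; apply: eq_bigr => k _.
  have -> : t * (y + k.+1%:R * (2 * pi)) =
      (t * y / 2 + 2 * pi * t + k%:R * (2 * (pi * t))) + t * y / 2.
    by rewrite -addn1 natrD; field.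
  have -> : t * (0 + k.+1%:R * (2 * pi)) =
      (t * y / 2 + 2 * pi * t + k%:R * (2 * (pi * t))) - t * y / 2.
    by rewrite -addn1 natrD; field.
  by rewrite sinB sinD; ring.
rewrite (_ : (fun _ => _) = (fun n => 1 + \int[mu]_(t in `]0, 1[)
    (bweight t * (2 * sin (t * y / 2)) * dirichlet y n t))); last exact/funext.
rewrite -[X in _ --> X]addr0; apply: cvgD; first exact: cvg_cst.
have mD : measurable (`]0, 1[%classic : set R) by [].
have mf : measurable_fun (`]0, 1[%classic : set R) (fun t => bweight t * (2 * sin (t * y / 2))).
  apply: measurable_funM; first exact: measurable_bweight.
  apply: measurable_funTS; apply: continuous_measurable_fun => t.
  apply: cvgM; first exact: cvg_cst.
  by under eq_fun do rewrite -mulrA; rewrite -mulrA; exact: continuous_sinM.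
have mfd n : measurable_fun (`]0, 1[%classic : set R)
    (fun t => bweight t * (2 * sin (t * y / 2)) * dirichlet y n t).
  apply: measurable_funM => //; apply: measurable_funM => //.
  apply: measurable_funTS; apply: measurable_sum => k.
  apply: measurableT_comp; first by apply: continuous_measurable_fun; exact: continuous_cos.
  apply: measurable_funD; last by apply: measurable_funM => //; apply: measurable_funM => //; apply: measurable_funM.
  apply: measurable_funD; last exact: measurable_funM.
  by apply: measurable_funM => //; exact: measurable_funM.
have bf n t : 0 < t < 1 ->
    `|bweight t * (2 * sin (t * y / 2)) * dirichlet y n t| <= 2 / pi * `|y|.
  move=> /[dup] t01 /andP[t0 _].
  have h : `|bweight t * (2 * sin (t * y / 2))| <= 2 / pi * `|y|.
    apply: bweightM_bounded => //.
    rewrite normrM [X in X * _]ger0_norm// -mulrA.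
    have := norm_sinM_le (y / 2) t0; rewrite normrM [`|2^-1|]ger0_norm//; lra.
  rewrite normrM -[leRHS]mulr1; apply: ler_pM => //; exact: dirichlet_le1.
have [|||||_ _] := @dominated_convergence _ _ _ mu `]0%R, 1%R[%classic mD
   (fun n t => (bweight t * (2 * sin (t * y / 2)) * dirichlet y n t)%:E) (cst 0%E)
   (cst (2 / pi * `|y|)%:E).
- by move=> n; apply/measurable_EFinP; exact: mfd.
- exact: measurable_cst.
- apply: aeW => t /=; rewrite in_itv/= => t01.
  apply: cvg_EFin; first exact: nearW.
  rewrite -[X in _ --> X](mulr0 (bweight t * (2 * sin (t * y / 2)))).
  by apply: cvgM; [exact: cvg_cst|exact: cvg_dirichlet].
- have := @integrable_bounded01 _ (cst (2 / pi * `|y|)) (`|2 / pi * `|y| |).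
  by apply => //; exact: measurable_cst.
- apply: aeW => t n /=; rewrite in_itv/= => t01.
  by rewrite lee_fin bf.
rewrite integral_cst//= mul0e => /fine_cvg.
exact.
Qed.

(** [bfun] increases along y + 2 pi k, so its value at y is at most the limit of
    its Cesaro means. *)
Lemma bfun_le1 y : 0 < y -> bfun y <= 1.
Proof.
move=> y0; have p0 := pi_gt0 R.
apply: (cvgr_to_ge (cvg_bfun_cesaro y)); apply: nearW => n.
rewrite ler_pdivlMl// [leLHS]mulr_natl (_ : bfun y *+ n.+1 = \sum_(k < n.+1) bfun y); last first.
  by rewrite sumr_const card_ord.
apply: ler_sum => -[k /= _] _; elim: k => [|k IHk]; first by rewrite mul1r bfun_incr.
apply: (le_trans IHk).
have -> : y + k.+2%:R * (2 * pi) = y + k.+1%:R * (2 * pi) + 2 * pi.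
  by rewrite -addn1 natrD; ring.
by rewrite bfun_incr// addr_gt0// mulr_gt0//; lra.
Qed.

(** Along y + 2 pi k the sum of [bfun] and [fejer] decreases, while it dominates
    [bfun], whose Cesaro means tend to 1. *)
Lemma bfun_fejer_ge1 y : 0 < y -> 1 <= bfun y + fejer y.
Proof.
move=> y0; have p0 := pi_gt0 R.
apply: (cvgr_to_le (cvg_bfun_cesaro y)); apply: nearW => n.
rewrite ler_pdivrMl// [leRHS]mulr_natl (_ : (bfun y + fejer y) *+ n.+1 = \sum_(k < n.+1) (bfun y + fejer y)); last first.
  by rewrite sumr_const card_ord.
apply: ler_sum => -[k /= _] _.
apply: (@le_trans _ _ (bfun (y + k.+1%:R * (2 * pi)) + fejer (y + k.+1%:R * (2 * pi)))).
  by rewrite lerDl fejer_ge0.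
elim: k => [|k IHk]; first by rewrite mul1r bfun_fejer_decr.
apply: le_trans IHk.
have -> : y + k.+2%:R * (2 * pi) = y + k.+1%:R * (2 * pi) + 2 * pi.
  by rewrite -addn1 natrD; ring.
by rewrite bfun_fejer_decr// addr_gt0// mulr_gt0//; lra.
Qed.

Lemma bfun_minorant y : (1 + bfun y - fejer y) / 2 <= (0 <= y)%R%:R.
Proof.
have [y0|y0|<-] := ltgtP 0 y; rewrite /= ?mulr1n ?mulr0n.
- by have := bfun_le1 y0; have := fejer_ge0 y; lra.
- have := @bfun_fejer_ge1 (- y); rewrite oppr_gt0 => /(_ y0).
  by rewrite bfunN fejerN; lra.
- by rewrite bfun0 fejer0; lra.
Qed.

Lemma bfun_majorant y : (0 <= y)%R%:R <= (1 + bfun y + fejer y) / 2.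
Proof.
have [y0|y0|<-] := ltgtP 0 y; rewrite /= ?mulr1n ?mulr0n.
- by have := bfun_fejer_ge1 y0; lra.
- have := @bfun_le1 (- y); rewrite oppr_gt0 => /(_ y0).
  by rewrite bfunN; have := fejer_ge0 y; lra.
- by rewrite bfun0 fejer0; lra.
Qed.

End beurling.

(** * Fourier transform of the Gaussian density *)

Section gauss.
Context {R : realType}.
Notation mu := (@lebesgue_measure R).
Implicit Types (t x y T : R) (f : R -> R).

Definition gpdf x : R := (Num.sqrt (2 * pi))^-1 * expR (- (2^-1 * x ^+ 2)).

Lemma gpdfE : gpdf = normal_pdf 0 1.
Proof.
apply/funext => x; rewrite normal_pdfE ?oner_neq0// /gpdf /normal_peak /normal_fun.
have -> : 1 ^+ 2 * pi *+ 2 = 2 * pi :> R by rewrite expr1n mul1r mulr_natl.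
by have -> : - (x - 0) ^+ 2 / (1 ^+ 2 *+ 2) = - (2^-1 * x ^+ 2) by rewrite subr0 expr1n mulNr mulrC.
Qed.

Lemma gpdf_ge0 x : 0 <= gpdf x.
Proof. by rewrite gpdfE normal_pdf_ge0. Qed.

Lemma continuous_gpdf : continuous gpdf.
Proof. by rewrite gpdfE; apply: continuous_normal_pdf; exact: oner_neq0. Qed.

Lemma measurable_gpdf : measurable_fun [set: R] gpdf.
Proof. by apply: continuous_measurable_fun; exact: continuous_gpdf. Qed.

Lemma integral_gpdf : (\int[mu]_x (gpdf x)%:E = 1)%E.
Proof. by rewrite gpdfE integral_normal_pdf. Qed.

Lemma integrable_gpdf : mu.-integrable [set: R] (EFin \o gpdf).
Proof. by rewrite gpdfE; exact: integrable_normal_pdf. Qed.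

Lemma is_derive_gpdf x : is_derive x 1 gpdf (- (x * gpdf x)).
Proof.
apply: is_derive_eq; rewrite /GRing.scale/= /gpdf; lra.
Qed.

(** Half of the Gaussian exponent absorbs the factor |x|; the other half is the
    density of variance 2. *)
Lemma gpdf_moment_le x : `|x| * gpdf x <= Num.sqrt 2 * normal_pdf 0 (Num.sqrt 2) x.
Proof.
rewrite normal_pdfE ?sqrtr_eq0 -?ltNge// /gpdf /normal_peak /normal_fun.
have -> : Num.sqrt 2 ^+ 2 * pi *+ 2 = 2 * (2 * pi) :> R.
  by rewrite sqr_sqrtr// -mulr_natl.
have -> : - (x - 0) ^+ 2 / (Num.sqrt 2 ^+ 2 *+ 2) = - (x ^+ 2 / 4).
  by rewrite sqr_sqrtr// subr0 -mulr_natl; field.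
have s2 : Num.sqrt 2 != 0 :> R by rewrite sqrtr_eq0 -ltNge.
rewrite [Num.sqrt (2 * (2 * pi))]sqrtrM// invfM [leRHS]mulrA [Num.sqrt 2 * _]mulrA mulfV// mul1r.
rewrite mulrCA ler_wpM2l ?invr_ge0 ?sqrtr_ge0//.
rewrite (_ : - (2^-1 * x ^+ 2) = - (x ^+ 2 / 4) + - (x ^+ 2 / 4)); last by field.
rewrite expRD mulrA ler_piMl ?expR_ge0// expRN ler_pdivrMr ?expR_gt0// mul1r.
apply: (le_trans _ (expR_ge1Dx _)); rewrite -[x ^+ 2]real_normK ?num_real//.
by have := sqr_ge0 (`|x| - 2); lra.
Qed.

Lemma integrable_gpdf_moment :
  mu.-integrable [set: R] (EFin \o (fun x => `|x| * gpdf x)).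
Proof.
have h := @integrable_realZ _ _ _ mu _ measurableT _ (Num.sqrt 2)
  (integrable_normal_pdf 0 (Num.sqrt 2)).
apply: le_integrable h => //.
  apply/measurable_EFinP; apply: measurable_funM; last exact: measurable_gpdf.
  exact: normr_measurable.
move=> x _; rewrite /= lee_fin [X in _ <= X]ger0_norm ?mulr_ge0 ?normal_pdf_ge0//.
by rewrite ger0_norm ?mulr_ge0 ?gpdf_ge0// gpdf_moment_le.
Qed.

(** Linear growth is what the transforms below need: [bfun], differentiation in t
    and integration by parts all produce a factor |x| at most. *)
Lemma integrable_gpdfM f (a b : R) : measurable_fun [set: R] f ->
  (forall x, `|f x| <= a + b * `|x|) ->
  mu.-integrable [set: R] (EFin \o (fun x => f x * gpdf x)).
Proof.
move=> mf fab.
have h := integrable_realD measurableT (integrable_realZ measurableT a integrable_gpdf)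
  (integrable_realZ measurableT b integrable_gpdf_moment).
apply: le_integrable h => //.
  by apply/measurable_EFinP; apply: measurable_funM => //; exact: measurable_gpdf.
move=> x _; rewrite /= lee_fin; apply: le_trans (ler_norm _).
rewrite normrM [X in _ * X]ger0_norm ?gpdf_ge0//.
by have := ler_wpM2r (gpdf_ge0 x) (fab x); rewrite /=; lra.
Qed.

(** After rescaling, the integrand is a centered Gaussian density of standard
    deviation 1/T, and [0, 1] lies in a half-line of mass 1/2. *)
Lemma gpdf_half_mass T : 0 < T ->
  \int[mu]_(t in `]0, 1[) expR (- (2^-1 * (t * T) ^+ 2)) <= Num.sqrt (2 * pi) / (2 * T).
Proof.
move=> T0; have T0' := lt0r_neq0 T0.
have p0 : 0 < Num.sqrt (2 * pi) :> R by rewrite sqrtr_gt0 mulr_gt0// pi_gt0.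
have TV0 : T^-1 != 0 by rewrite invr_eq0.
have E t : expR (- (2^-1 * (t * T) ^+ 2)) = Num.sqrt (2 * pi) / T * normal_pdf 0 T^-1 t.
  rewrite normal_pdfE// /normal_peak /normal_fun.
  have -> : T^-1 ^+ 2 * pi *+ 2 = T^-1 ^+ 2 * (2 * pi) :> R by rewrite -mulr_natl; ring.
  have -> : - (t - 0) ^+ 2 / (T^-1 ^+ 2 *+ 2) = - (2^-1 * (t * T) ^+ 2).
    by rewrite subr0 -mulr_natl; field.
  rewrite [Num.sqrt (T^-1 ^+ 2 * _)]sqrtrM ?sqr_ge0// sqrtr_sqr ger0_norm ?invr_ge0 ?(ltW T0)//.
  move: (Num.sqrt _) (expR _) (lt0r_neq0 p0) => p e pn0.
  by field; rewrite T0'.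
have I1 : mu.-integrable [set: R] (EFin \o normal_pdf 0 T^-1).
  exact: integrable_normal_pdf.
have mI : measurable (`]0, 1[%classic : set R) by [].
have I01 : mu.-integrable `]0, 1[ (EFin \o normal_pdf 0 T^-1).
  by apply: integrableS I1.
under eq_Rintegral do rewrite E.
rewrite RintegralZl//.
have h : 2 * \int[mu]_(t in `]0, 1[) normal_pdf 0 T^-1 t <= 1.
  have int0 : (0 <= \int[mu]_(t in `]0%R, 1%R[) (normal_pdf 0 T^-1 t)%:E)%E.
    by apply: integral_ge0 => t _; rewrite lee_fin normal_pdf_ge0.
  have fin : (\int[mu]_(t in `]0%R, 1%R[) (normal_pdf 0 T^-1 t)%:E)%E \is a fin_num.
    exact: integrable_fin_num.
  rewrite -lee_fin EFinM fineK// -(integral_normal_pdf 0 T^-1).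
  rewrite ge0_symfun_integralT//; last 3 first.
  - by move=> x; exact: normal_pdf_ge0.
  - exact: continuous_normal_pdf.
  - by move=> x; rewrite /= normal_pdfE// /normal_fun !subr0 sqrrN.
  rewrite lee_pmul2l// ge0_subset_integral//.
  - by rewrite -set_itvcy.
  - apply/measurable_EFinP; apply: measurable_funTS; exact: measurable_normal_pdf.
  - by move=> x _; rewrite lee_fin normal_pdf_ge0.
  - by move=> x /=; rewrite in_itv/= => /andP[/ltW].
have k0 : 0 <= Num.sqrt (2 * pi) / T by rewrite divr_ge0// ltW.
have := ler_wpM2l k0 h.
rewrite (_ : Num.sqrt (2 * pi) / (2 * T) = Num.sqrt (2 * pi) / T / 2); last by field.
by rewrite mulr1 => kI; rewrite ler_pdivlMr// -mulrA [X in _ * X]mulrC.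
Qed.

Implicit Types a : R.

Lemma continuous_cosMD t a : continuous (fun x => cos (t * x + a)).
Proof.
move=> x; apply: (continuous_comp (f := fun x => t * x + a)); last exact: continuous_cos.
by apply: cvgD; [exact: mulrl_continuous|exact: cvg_cst].
Qed.

Lemma continuous_sinMD t a : continuous (fun x => sin (t * x + a)).
Proof.
move=> x; apply: (continuous_comp (f := fun x => t * x + a)); last exact: continuous_sin.
by apply: cvgD; [exact: mulrl_continuous|exact: cvg_cst].
Qed.

Lemma integrable_cos_gpdf t a :
  mu.-integrable [set: R] (EFin \o (fun x => cos (t * x + a) * gpdf x)).
Proof.
apply: (@integrable_gpdfM _ 1 0) => [|x]; last by rewrite mul0r addr0 cos_max.
by apply: continuous_measurable_fun; exact: continuous_cosMD.
Qed.

Lemma integrable_xsin_gpdf t a :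
  mu.-integrable [set: R] (EFin \o (fun x => x * sin (t * x + a) * gpdf x)).
Proof.
apply: (@integrable_gpdfM _ 0 1) => [|x].
  apply: continuous_measurable_fun => x; apply: cvgM; first exact: cvg_id.
  exact: continuous_sinMD.
by rewrite normrM add0r mul1r ler_piMr// sin_max.
Qed.

(** Quadratic decay suffices for the boundary terms of an integration by
    parts over the line. *)
Lemma gpdf_le x : gpdf x <= (1 + 2^-1 * x ^+ 2)^-1.
Proof.
rewrite /gpdf -[leRHS]mul1r; apply: ler_pM; rewrite ?invr_ge0 ?sqrtr_ge0 ?expR_ge0//.
  rewrite invf_le1; last by rewrite sqrtr_gt0 mulr_gt0// pi_gt0.
  by rewrite -[leLHS]sqrtr1 ler_sqrt; have := pi_ge2 R; lra.
rewrite expRN lef_pV2 ?posrE ?expR_gt0 ?expR_ge1Dx//.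
by have := sqr_ge0 x; lra.
Qed.

(** Integration by parts over the line: on [-n, n] the integral is
    F n - F (- n), which tends to 0 because the Gaussian density dominates F. *)
Lemma Rintegral_derive_gpdf f F : (forall x, is_derive x 1 F (f x)) ->
  continuous f -> mu.-integrable [set: R] (EFin \o f) ->
  (forall x, `|F x| <= gpdf x) -> \int[mu]_x f x = 0.
Proof.
move=> FE cf intf Fg.
pose D n : set R := `[- n.+1%:R, n.+1%:R]%classic.
have cF : continuous F.
  by move=> x; apply/differentiable_continuous/derivable1_diffP; have ? := FE x; exact: ex_derive.
have mT : measurable [set: R] by [].
have mD n : measurable (D n) by rewrite /D; exact: measurable_itv.
have mf : measurable_fun [set: R] f by exact: continuous_measurable_fun.
have mfn n : measurable_fun [set: R] (f \_ (D n)).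
  by apply: (measurable_restrictT f (mD n)).1; exact: measurable_funTS.
have ID n : \int[mu]_x ((f \_ (D n)) x) = F n.+1%:R - F (- n.+1%:R).
  rewrite -Rintegral_mkcond /Rintegral (@continuous_FTC2 _ f F)//.
  - by have : (0 : R) < n.+1%:R by []; lra.
  - exact: continuous_subspaceT.
  - split.
    + by move=> x _; have ? := FE x; exact: ex_derive.
    + by apply: cvg_at_right_filter; exact: cF.
    + by apply: cvg_at_left_filter; exact: cF.
  - by move=> x _; rewrite derive1E; have ? := FE x; rewrite derive_val.
have [|||||_ _] := @dominated_convergence _ _ _ mu setT mT
   (fun n x => ((f \_ (D n)) x)%:E) (EFin \o f) (EFin \o (fun x => `|f x|)).
- by move=> n; apply/measurable_EFinP; exact: mfn.
- by apply/measurable_EFinP.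
- apply: aeW => x _; apply: cvg_EFin; first exact: nearW.
  apply: cvg_near_cst; near=> n.
  rewrite /= patchE ifT// inE /D /= in_itv/= -ler_norml.
  apply: (@le_trans _ _ n%:R); last by rewrite ler_nat.
  by near: n; exact: nbhs_infty_ger.
- exact: integrable_norm.
- apply: aeW => x n _ /=; rewrite lee_fin patchE.
  by case: ifPn => // _; rewrite normr0.
have -> : (\int[mu]_x (EFin \o f) x)%E = (\int[mu]_x f x)%:E.
  by rewrite /Rintegral fineK//; exact: integrable_fin_num.
move=> /fine_cvg h; apply: (cvg_unique _ h) => //.
rewrite (_ : fine \o _ = (fun n => F n.+1%:R - F (- n.+1%:R))); last first.
  by apply/funext => n; rewrite /= -ID.
apply/norm_cvg0P.
apply: (@squeeze_cvgr _ _ _ _ (fun=> 0) (fun n => 4 * n.+1%:R^-1)).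
- apply: nearW => n; rewrite normr_ge0/=.
  apply: (le_trans (ler_normB _ _)).
  have n0 : (0 : R) < n.+1%:R by [].
  have h1 := le_trans (Fg n.+1%:R) (gpdf_le _).
  have h2 := le_trans (Fg (- n.+1%:R)) (gpdf_le _).
  rewrite sqrrN in h2.
  apply: (le_trans (lerD h1 h2)).
  suff : (1 + 2^-1 * n.+1%:R ^+ 2)^-1 <= 2 * n.+1%:R^-1 :> R.
    by move: (_^-1) (_^-1) => u v; lra.
  have -> : 2 * n.+1%:R^-1 = (n.+1%:R / 2)^-1 :> R by rewrite invfM invrK mulrC.
  move: (n.+1%:R : R) n0 => m m0; have m2 := sqr_ge0 m.
  rewrite lef_pV2 ?posrE ?divr_gt0//; last by lra.
  by have := sqr_ge0 (m - 1); lra.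
- exact: cvg_cst.
- rewrite -[X in _ --> X](mulr0 4); apply: cvgM; first exact: cvg_cst.
  exact: cvg_harmonic.
Unshelve. all: by end_near.
Qed.

(** Stein's identity E[G f(G)] = E[f'(G)] for f(x) = sin (t x + a). *)
Lemma gauss_mean_xsin t a : \int[mu]_x (x * sin (t * x + a) * gpdf x) =
  t * \int[mu]_x (cos (t * x + a) * gpdf x).
Proof.
have FE x : is_derive x 1 (fun x => sin (t * x + a) * gpdf x)
   (t * (cos (t * x + a) * gpdf x) - x * sin (t * x + a) * gpdf x).
  have dg := is_derive_gpdf x.
  by apply: is_derive_eq; rewrite /GRing.scale/=; lra.
apply/esym/eqP; rewrite -subr_eq0 -RintegralZl//; last exact: integrable_cos_gpdf.
rewrite -RintegralB//; last 2 first.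
- by apply: integrable_realZ => //; exact: integrable_cos_gpdf.
- exact: integrable_xsin_gpdf.
apply/eqP; apply: (Rintegral_derive_gpdf FE).
- move=> x; apply: cvgB.
    apply: cvgM; first exact: cvg_cst.
    by apply: cvgM; [exact: continuous_cosMD|exact: continuous_gpdf].
  apply: cvgM; last exact: continuous_gpdf.
  by apply: cvgM; [exact: cvg_id|exact: continuous_sinMD].
- apply: integrable_realB => //; last exact: integrable_xsin_gpdf.
  by apply: integrable_realZ => //; exact: integrable_cos_gpdf.
- by move=> x; rewrite normrM [X in _ * X]ger0_norm ?gpdf_ge0// ler_piMl ?gpdf_ge0// sin_max.
Qed.

Let gcos a t := \int[mu]_x (cos (t * x + a) * gpdf x).

Let is_derive_gcos a t : is_derive t 1 (gcos a) (- (t * gcos a t)).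
Proof.
pose f t x : R := cos (t * x + a) * gpdf x.
have df (s x : R) : is_derive s 1 (fun t => f t x) (- (x * sin (s * x + a) * gpdf x)).
  by apply: is_derive_eq; rewrite /GRing.scale/=; lra.
have d1E (s x : R) : partial1of2 f s x = - (x * sin (s * x + a) * gpdf x).
  by rewrite partial1of2E; have ? := df s x; rewrite derive_val.
have tI : [set` `]t - 1, t + 1[] t by rewrite /= in_itv/=; apply/andP; lra.
have intf s : [set` `]t - 1, t + 1[] s -> mu.-integrable [set: R] (EFin \o f s).
  by move=> _; exact: integrable_cos_gpdf.
have derf (s x : R) : [set` `]t - 1, t + 1[] s -> [set: R] x -> derivable (f ^~ x) s 1.
  by move=> _ _; have ? := df s x; exact: ex_derive.
have G0 x : 0 <= `|x| * gpdf x by rewrite mulr_ge0 ?gpdf_ge0.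
have Gub (s x : R) : [set` `]t - 1, t + 1[] s -> [set: R] x -> `|partial1of2 f s x| <= `|x| * gpdf x.
  move=> _ _; rewrite d1E normrN normrM [X in _ * X]ger0_norm ?gpdf_ge0//.
  by rewrite ler_wpM2r ?gpdf_ge0// normrM ler_piMr// sin_max.
have ex := derivable_under_integral measurableT tI intf derf G0 integrable_gpdf_moment Gub.
have eq := differentiation_under_integral measurableT tI intf derf G0 integrable_gpdf_moment Gub.
apply: DeriveDef => //; rewrite -derive1E eq.
under eq_Rintegral do rewrite d1E -mulN1r.
by rewrite RintegralZl//; [rewrite gauss_mean_xsin mulN1r|exact: integrable_xsin_gpdf].
Qed.

(** As a function of t, the mean g satisfies g' = - t g by [gauss_mean_xsin], so
    g(t) e^{t^2/2} is constant. *)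
Lemma gauss_mean_cos t a :
  \int[mu]_x (cos (t * x + a) * gpdf x) = cos a * expR (- (2^-1 * t ^+ 2)).
Proof.
have : gcos a t * expR (2^-1 * t ^+ 2) = gcos a 0 * expR (2^-1 * 0 ^+ 2).
  apply: (@is_derive_0_is_cst _ (fun t => gcos a t * expR (2^-1 * t ^+ 2))) => s.
  have ds := is_derive_gcos a s.
  by apply: is_derive_eq; rewrite /GRing.scale/=; lra.
have -> : gcos a 0 = cos a.
  rewrite /gcos; under eq_Rintegral do rewrite mul0r add0r.
  rewrite RintegralZl//; last exact: integrable_gpdf.
  by rewrite /Rintegral integral_gpdf mulr1.
rewrite expr0n/= mulr0 expR0 mulr1 => <-.
by rewrite expRN mulfK// gt_eqF// expR_gt0.
Qed.

Lemma gauss_mean_sin t a :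
  \int[mu]_x (sin (t * x + a) * gpdf x) = sin a * expR (- (2^-1 * t ^+ 2)).
Proof.
rewrite -[sin a]cosBpihalf -gauss_mean_cos; apply: eq_Rintegral => x _.
by rewrite addrA cosBpihalf.
Qed.

End gauss.

Section fubini.
Context {R : realType}.
Notation mu := (@lebesgue_measure R).

Local Notation GR := (measurableTypeR R).

(** A bound M(y) uniform in t and integrable over the line makes the integrand
    integrable on the product of ]0, 1[ with the line. *)
Lemma Rfubini01 (f : GR * GR -> R) (M : R -> R) :
  measurable_fun [set: GR * GR] f -> mu.-integrable [set: R] (EFin \o M) ->
  (forall t y, 0 < t < 1 -> `|f (t, y)| <= M y) ->
  mu.-integrable [set: R] (EFin \o (fun y => \int[mu]_(t in `]0, 1[) f (t, y))) /\
  \int[mu]_y \int[mu]_(t in `]0, 1[) f (t, y) =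
  \int[mu]_(t in `]0, 1[) \int[mu]_y f (t, y).
Proof.
move=> mf iM fM.
pose I : set R := `]0, 1[%classic.
have mI : measurable I by exact: measurable_itv.
pose F (z : GR * GR) : \bar R := (f z * \1_I z.1)%:E.
have mF : measurable_fun setT F.
  apply/measurable_EFinP; apply: measurable_funM => //.
  by apply: measurableT_comp => //; exact: measurable_indic.
have my t : measurable_fun [set: GR] (fun y => f (t, y)).
  by apply: measurableT_comp => //; exact: measurable_pair1.
have mt y : measurable_fun [set: GR] (fun t => f (t, y)).
  by apply: measurableT_comp => //; exact: measurable_pair2.
have iy t : 0 < t < 1 -> mu.-integrable [set: R] (EFin \o (fun y => f (t, y))).
  move=> t01; apply: le_integrable iM => //.
    by apply/measurable_EFinP; exact: my.
  by move=> y _; rewrite /= lee_fin (le_trans (fM t y t01))// ler_norm.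
have it y : mu.-integrable I (EFin \o (fun t => f (t, y))).
  apply: (@integrable_bounded01 _ _ (M y)); first by apply: measurable_funTS; exact: mt.
  by move=> t; exact: fM.
have Ft t : (\int[mu]_y F (t, y))%E = (((fun t => \int[mu]_y f (t, y)) \_ I) t)%:E.
  rewrite patchE; case: ifPn => tI; rewrite /F /= indicE ?tI.
    under eq_integral do rewrite mulr1.
    by rewrite /Rintegral fineK//; apply: integrable_fin_num => //; apply: iy; move: tI; rewrite inE /I/= in_itv.
  rewrite (negbTE tI); under eq_integral do rewrite mulr0.
  by rewrite integral0.
have Fy y : (\int[mu]_t F (t, y))%E = (\int[mu]_(t in I) f (t, y))%:E.
  rewrite /Rintegral fineK; last by apply: integrable_fin_num; [exact: mI|exact: it].
  rewrite [RHS]integral_mkcond; apply: eq_integral => t _.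
  by rewrite patchE /F /= indicE; case: ifPn => tI; rewrite ?mulr1 ?mulr0.
have iF : (mu \x mu)%E.-integrable setT F.
  apply: (@integrable12ltyP _ _ _ _ _ mu mu F mF).2.
  pose m := (\int[mu]_y `|(M y)%:E|)%E.
  have m0 : (0 <= m)%E by exact: integral_ge0.
  have moo : (m < +oo)%E by case/integrableP : iM.
  apply: (@le_lt_trans _ _ (\int[mu]_t (m * (\1_I t)%:E))%E).
    apply: ge0_le_integral => //.
    - by move=> t _; exact: integral_ge0.
    - apply: (measurable_fun_fubini_tonelli_F (abse \o F)); last by move=> z; rewrite /= lee_fin.
      exact: measurableT_comp.
    - by apply: measurable_funeM; apply/measurable_EFinP; exact: measurable_indic.
    - move=> t _; rewrite indicE; case: (boolP (t \in I)) => tI; last first.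
        under eq_integral do rewrite /F /= indicE (negbTE tI) mulr0 normr0.
        by rewrite integral0 mule0.
      rewrite mule1; apply: ge0_le_integral => //.
      + apply: measurableT_comp => //; apply/measurable_EFinP.
        have mc : measurable_fun [set: GR] (fun y : GR => (\1_I t : R)) by exact: measurable_cst.
        by apply: (measurable_funM (my t) mc).
      + by apply: measurableT_comp => //; case/integrableP : iM.
      + move=> y _; rewrite /F /= indicE tI mulr1 lee_fin.
        rewrite (le_trans (fM t y _)) ?ler_norm//.
        by move: tI; rewrite inE /I/= in_itv.
  rewrite ge0_integralZl//; first last.
  - by apply/measurable_EFinP; exact: measurable_indic.
  rewrite integral_indic// setIT /I /= lebesgue_measure_itv/= lte_fin ltr01 oppr0 adde0.
  by rewrite mule1.
split.
  apply: le_integrable iM => //.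
    have mG := @measurable_fubini_G _ _ _ _ _ mu mu F iF.
    rewrite (_ : _ \o _ = fubini_G mu F)//.
    by apply/funext => y; rewrite /fubini_G Fy.
  move=> y _; rewrite /= lee_fin.
  apply: (le_trans (le_normr_Rintegral _ (it y))) => //.
  apply: (@le_trans _ _ (\int[mu]_(t in I) `|M y|)).
    apply: le_Rintegral => //; first exact: (integrable_norm (it y)).
      by apply: (@integrable_bounded01 _ _ `|M y|) => // t _; rewrite normr_id.
    move=> t It; rewrite (le_trans (fM t y _)) ?ler_norm//.
  rewrite Rintegral_cst// /I /= lebesgue_measure_itv/= lte_fin ltr01 oppr0 adde0/=.
  by rewrite mulr1.
have := @Fubini _ _ _ _ _ mu mu F iF.
under eq_integral do rewrite Ft.
under [X in _ = X -> _]eq_integral do rewrite Fy.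
move=> /(congr1 fine); rewrite -/(Rintegral _ _ _) -/(Rintegral _ _ _) => h.
by rewrite [RHS]Rintegral_mkcond h.
Qed.

End fubini.

(** * Smoothing inequality for finitely supported laws *)

Section finite_laws.
Context {R : realType}.
Implicit Types (s : seq (R * R)) (f g : R -> R).

(** A finitely supported law is a list of (mass, value) pairs.  Values may repeat,
    so that mixtures and images of laws are concatenations and maps of lists. *)
Definition lmean s f : R := \sum_(a <- s) a.1 * f a.2.

Definition is_law s := (forall a, a \in s -> 0 <= a.1) /\ lmean s (cst 1) = 1.

Lemma lmeanD s f g : lmean s (fun v => f v + g v) = lmean s f + lmean s g.
Proof. by rewrite /lmean -big_split; apply: eq_bigr => a _; rewrite mulrDr. Qed.

Lemma lmeanZ s k f : lmean s (fun v => k * f v) = k * lmean s f.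
Proof. by rewrite /lmean mulr_sumr; apply: eq_bigr => a _; rewrite mulrCA. Qed.

Lemma lmeanN s f : lmean s (fun v => - f v) = - lmean s f.
Proof. by rewrite /lmean -sumrN; apply: eq_bigr => a _; rewrite mulrN. Qed.

Lemma lmeanB s f g : lmean s (fun v => f v - g v) = lmean s f - lmean s g.
Proof. by rewrite lmeanD lmeanN. Qed.

Lemma lmean_cst s k : is_law s -> lmean s (cst k) = k.
Proof.
move=> [_ s1]; rewrite (_ : cst k = fun v => k * cst 1 v); last first.
  by apply/funext => v; rewrite mulr1.
by rewrite lmeanZ s1 mulr1.
Qed.

Lemma eq_lmean s f g : f =1 g -> lmean s f = lmean s g.
Proof. by move=> fg; apply: eq_bigr => a _; rewrite fg. Qed.

Lemma le_lmean s f g : is_law s -> (forall v, f v <= g v) -> lmean s f <= lmean s g.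
Proof.
move=> [s0 _] fg; rewrite /lmean big_seq [leRHS]big_seq; apply: ler_sum => a /s0 a0.
by rewrite ler_wpM2l.
Qed.

Lemma lmean_ge0 s f : is_law s -> (forall v, 0 <= f v) -> 0 <= lmean s f.
Proof.
move=> sP f0; rewrite -(lmean_cst 0 sP); exact: le_lmean.
Qed.

End finite_laws.

Section smoothing.
Context {R : realType}.
Notation mu := (@lebesgue_measure R).
Implicit Types (s : seq (R * R)).

Lemma integrable_lmean s (D : set R) (f : R -> R -> R) :
  measurable D -> (forall v, mu.-integrable D (EFin \o f v)) ->
  mu.-integrable D (EFin \o (fun t => lmean s (fun v => f v t))).
Proof.
move=> mD fi; elim: s => [|a s IHs].
  rewrite (_ : _ \o _ = cst 0%E); first exact: integrable0.
  by apply/funext => t; rewrite /= /lmean big_nil.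
rewrite (_ : _ \o _ = EFin \o (fun t => a.1 * f a.2 t + lmean s (fun v => f v t))).
  by apply: integrable_realD => //; exact: integrable_realZ.
by apply/funext => t; rewrite /= /lmean big_cons.
Qed.

Lemma Rintegral_lmean s (D : set R) (f : R -> R -> R) :
  measurable D -> (forall v, mu.-integrable D (EFin \o f v)) ->
  \int[mu]_(t in D) lmean s (fun v => f v t) =
  lmean s (fun v => \int[mu]_(t in D) f v t).
Proof.
move=> mD fi; elim: s => [|a s IHs].
  rewrite /lmean big_nil; under eq_Rintegral do rewrite big_nil.
  by rewrite Rintegral_cst// mul0r.
have E g : lmean (a :: s) g = a.1 * g a.2 + lmean s g by rewrite /lmean big_cons.
under eq_Rintegral do rewrite E.
rewrite RintegralD//; first by rewrite RintegralZl// IHs E.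
- exact: integrable_realZ.
- exact: integrable_lmean.
Qed.

Lemma sinB_scale (t T x v : R) :
  sin (t * (T * (x - v))) = sin (t * T * x) * cos (t * T * v) - cos (t * T * x) * sin (t * T * v).
Proof. by rewrite -sinB; congr sin; ring. Qed.

Lemma cosB_scale (t T x v : R) :
  cos (t * (T * (x - v))) = cos (t * T * x) * cos (t * T * v) + sin (t * T * x) * sin (t * T * v).
Proof. by rewrite -cosB; congr cos; ring. Qed.

Lemma lmean_bfun s T x : lmean s (fun v => bfun (T * (x - v))) =
  \int[mu]_(t in `]0, 1[) (bweight t * lmean s (fun v => sin (t * (T * (x - v))))).
Proof.
rewrite /bfun -Rintegral_lmean//; last by move=> v; exact: integrable_bfun.
by apply: eq_Rintegral => t _; rewrite lmeanZ.
Qed.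

Lemma integrable_fejer (y : R) :
  mu.-integrable `]0, 1[ (EFin \o (fun t : R => (1 - t) * cos (t * y))).
Proof. by apply: integrable_continuous01; exact: continuous_fejerM. Qed.

Lemma lmean_fejer s T x : lmean s (fun v => fejer (T * (x - v))) =
  2 * \int[mu]_(t in `]0, 1[) ((1 - t) * lmean s (fun v => cos (t * (T * (x - v))))).
Proof.
rewrite /fejer lmeanZ -Rintegral_lmean//; last by move=> v; exact: integrable_fejer.
by congr (_ * _); apply: eq_Rintegral => t _; rewrite lmeanZ.
Qed.

Local Notation GR := (measurableTypeR R).

(** Fubini for a kernel y |-> \int_0^1 w(t) h(t T (x - y)) dt against the Gaussian
    law, in a form that serves both [bfun] and [fejer]. *)
Lemma gauss_mean_swap (w h : R -> R) (a b T x : R) :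
  measurable_fun (`]0, 1[%classic : set R) w -> continuous h ->
  (forall z t, 0 < t < 1 -> `|w t * h (t * z)| <= a + b * `|z|) ->
  (forall z, mu.-integrable `]0, 1[ (EFin \o (fun t => w t * h (t * z)))) ->
  0 <= b ->
  (forall t, mu.-integrable [set: R] (EFin \o (fun y => h (t * (T * (x - y))) * gpdf y))) ->
  mu.-integrable [set: R]
    (EFin \o (fun y => (\int[mu]_(t in `]0, 1[) (w t * h (t * (T * (x - y))))) * gpdf y)) /\
  \int[mu]_y ((\int[mu]_(t in `]0, 1[) (w t * h (t * (T * (x - y))))) * gpdf y) =
  \int[mu]_(t in `]0, 1[) (w t * \int[mu]_y (h (t * (T * (x - y))) * gpdf y)).
Proof.
move=> mw ch wh iw b0 ih.
pose I : set R := `]0, 1[%classic.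
have mI : measurable I by exact: measurable_itv.
pose M y : R := (a + b * (`|T| * (`|x| + `|y|))) * gpdf y.
have iM : mu.-integrable [set: R] (EFin \o M).
  apply: (@integrable_gpdfM _ _ (`|a| + b * `|T| * `|x|) (b * `|T|)).
    apply: measurable_funD => //; apply: measurable_funM => //; apply: measurable_funM => //.
    by apply: measurable_funD => //; exact: normr_measurable.
  move=> y; apply: (le_trans (ler_normD _ _)); rewrite -addrA lerD//.
  by rewrite ger0_norm ?mulr_ge0 ?addr_ge0//; lra.
pose f (z : GR * GR) : R := (w \_ I) z.1 * h (z.1 * (T * (x - z.2))) * gpdf z.2.
have mf : measurable_fun [set: GR * GR] f.
  have m1 : measurable_fun [set: GR * GR] (fun z => z.1 : R) by exact: measurable_fst.
  have m2 : measurable_fun [set: GR * GR] (fun z => z.2 : R) by exact: measurable_snd.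
  apply: measurable_funM; last exact: (measurableT_comp measurable_gpdf m2).
  apply: measurable_funM.
    have mwI : measurable_fun [set: R] (w \_ I) by apply: (measurable_restrictT w mI).1.
    exact: (measurableT_comp mwI m1).
  have mh : measurable_fun [set: R] h by exact: continuous_measurable_fun.
  apply: (measurableT_comp mh); apply: measurable_funM => //; apply: measurable_funM => //.
  by apply: measurable_funB.
have fM (t y : R) : 0 < t < 1 -> `|f (t, y)| <= M y.
  move=> t01; rewrite /f /M/= patchE ifT; last by rewrite inE /I/= in_itv.
  rewrite normrM [X in _ * X]ger0_norm ?gpdf_ge0// ler_wpM2r ?gpdf_ge0//.
  apply: (le_trans (wh _ _ t01)); rewrite lerD2l ler_wpM2l// normrM ler_wpM2l//.
  exact: ler_normB.
have Ef t y : I t -> f (t, y) = w t * h (t * (T * (x - y))) * gpdf y.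
  by move=> It; rewrite /f /= patchE ifT// inE.
have fE y : (\int[mu]_(t in `]0, 1[) (w t * h (t * (T * (x - y))))) * gpdf y =
    \int[mu]_(t in `]0, 1[) f (t, y).
  rewrite -RintegralZr//.
  by apply: eq_Rintegral => t; rewrite inE => It; rewrite Ef.
have [if_ swap] := Rfubini01 mf iM fM.
have FE : (fun y => (\int[mu]_(t in `]0, 1[) (w t * h (t * (T * (x - y))))) * gpdf y) =
    (fun y => \int[mu]_(t in `]0, 1[) f (t, y)) by apply/funext => y; rewrite fE.
rewrite FE; split; first exact: if_.
rewrite swap; apply: eq_Rintegral => t; rewrite inE => It.
rewrite -(RintegralZl (w t) measurableT (ih t)).
by apply: eq_Rintegral => y _; rewrite (Ef t y It) -mulrA.
Qed.

Lemma gauss_mean_bfun T x :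
  mu.-integrable [set: R] (EFin \o (fun y => bfun (T * (x - y)) * gpdf y)) /\
  \int[mu]_y (bfun (T * (x - y)) * gpdf y) =
  \int[mu]_(t in `]0, 1[) (bweight t * (sin (t * T * x) * expR (- (2^-1 * (t * T) ^+ 2)))).
Proof.
have E t y : sin (t * (T * (x - y))) = sin (- (t * T) * y + t * T * x).
  by congr sin; ring.
have ib z : mu.-integrable `]0, 1[ (EFin \o (fun t : R => bweight t * sin (t * z))).
  exact: integrable_bfun.
have iS t : mu.-integrable [set: R] (EFin \o (fun y => sin (t * (T * (x - y))) * gpdf y)).
  under eq_fun do rewrite E.
  apply: (@integrable_gpdfM _ _ 1 0) => [|y]; last by rewrite mul0r addr0 sin_max.
  by apply: continuous_measurable_fun; exact: continuous_sinMD.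
have wb (z t : R) : 0 < t < 1 -> `|bweight t * sin (t * z)| <= 0 + 2 / pi * `|z|.
  move=> /[dup] t01 /andP[t0 _]; rewrite add0r; apply: bweightM_bounded => //.
  exact: norm_sinM_le.
have b0 : 0 <= 2 / pi :> R by rewrite divr_ge0// pi_ge0.
have [i1 i2] := gauss_mean_swap measurable_bweight (@continuous_sin R) wb ib b0 iS.
split; first exact: i1.
rewrite /bfun i2.
apply: eq_Rintegral => t _; under eq_Rintegral do rewrite E.
by rewrite gauss_mean_sin sqrrN.
Qed.

Lemma gauss_mean_fejer T x :
  mu.-integrable [set: R] (EFin \o (fun y => fejer (T * (x - y)) * gpdf y)) /\
  \int[mu]_y (fejer (T * (x - y)) * gpdf y) =
  2 * \int[mu]_(t in `]0, 1[) ((1 - t) * (cos (t * T * x) * expR (- (2^-1 * (t * T) ^+ 2)))).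
Proof.
have E t y : cos (t * (T * (x - y))) = cos (- (t * T) * y + t * T * x).
  by congr cos; ring.
have ic t : mu.-integrable [set: R] (EFin \o (fun y => cos (t * (T * (x - y))) * gpdf y)).
  by under eq_fun do rewrite E; exact: integrable_cos_gpdf.
have wb (z t : R) : 0 < t < 1 -> `|(1 - t) * cos (t * z)| <= 1 + 0 * `|z|.
  move=> /andP[t0 t1]; rewrite mul0r addr0 normrM ger0_norm; last by lra.
  rewrite -[leRHS]mulr1; apply: ler_pM => //; [lra|lra|exact: cos_max].
have mw : measurable_fun (`]0, 1[%classic : set R) (fun t : R => 1 - t).
  apply: measurable_funTS; apply: continuous_measurable_fun => t.
  by apply: cvgB; [exact: cvg_cst|exact: cvg_id].
have [i1 i2] := gauss_mean_swap mw (@continuous_cos R) wb integrable_fejer (lexx 0) ic.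
have fE y : fejer (T * (x - y)) * gpdf y =
    2 * ((\int[mu]_(t in `]0, 1[) ((1 - t) * cos (t * (T * (x - y))))) * gpdf y).
  by rewrite /fejer mulrA.
rewrite (funext fE); split; first exact: integrable_realZ.
rewrite (RintegralZl 2 measurableT i1) i2.
congr (_ * _); apply: eq_Rintegral => t _; under eq_Rintegral do rewrite E.
by rewrite gauss_mean_cos sqrrN.
Qed.

Lemma continuous_expR_scale (T k : R) :
  continuous (fun t : R => expR (- (k * (t * T) ^+ 2))).
Proof.
move=> t; apply: continuous_comp; last exact: continuous_expR.
apply: cvgN; apply: cvgM; first exact: cvg_cst.
by apply: cvgM; exact: mulrr_continuous.
Qed.

(** Dropping 1 - t and the cosine, both at most 1, leaves the Gaussian integral
    of [gpdf_half_mass]. *)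
Lemma gauss_mean_fejer_le T x : 0 < T ->
  \int[mu]_y (fejer (T * (x - y)) * gpdf y) <= Num.sqrt (2 * pi) / T.
Proof.
move=> T0; rewrite (gauss_mean_fejer T x).2.
have ce := @continuous_expR_scale T 2^-1.
have h : \int[mu]_(t in `]0, 1[) ((1 - t) * (cos (t * T * x) * expR (- (2^-1 * (t * T) ^+ 2))))
  <= \int[mu]_(t in `]0, 1[) expR (- (2^-1 * (t * T) ^+ 2)).
  apply: le_Rintegral => //.
  - apply: integrable_continuous01 => t; apply: cvgM.
      by apply: cvgB; [exact: cvg_cst|exact: cvg_id].
    apply: cvgM; last exact: ce.
    under eq_fun do rewrite -mulrA; rewrite -mulrA; exact: continuous_cosM.
  - exact: integrable_continuous01.
  - move=> t; rewrite /= in_itv/= => /andP[t0 t1]; rewrite mulrA ler_piMl ?expR_ge0//.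
    apply: (@le_trans _ _ (1 - t)); last by lra.
    by rewrite ler_piMr ?cos_le1//; lra.
have := le_trans h (gpdf_half_mass T0).
have -> : Num.sqrt (2 * pi) / (2 * T) = Num.sqrt (2 * pi) / T / 2.
  by field; rewrite lt0r_neq0.
lra.
Qed.

Lemma normal_cdfE x :
  mu.-integrable [set: R] (EFin \o (fun y => (y <= x)%R%:R * gpdf y)) /\
  normal_cdf x = \int[mu]_y ((y <= x)%R%:R * gpdf y).
Proof.
have E : (fun y => (y <= x)%R%:R * gpdf y) = gpdf \_ `]-oo, x].
  by apply/funext => y; rewrite patchE mem_setE in_itv/=; case: ifP; rewrite ?mul1r ?mul0r.
rewrite E; split.
  rewrite -restrict_EFin; apply/integrable_restrict => //.
  by rewrite setTI; apply: integrableS integrable_gpdf.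
rewrite -Rintegral_mkcond /normal_cdf /normal_prob /Rintegral.
by rewrite gpdfE.
Qed.

(** Cauchy-Schwarz between (u, v) and the weights of the two kernels.  Multiplied
    by t these weights are at most 2 / pi and 1 / 2, and
    sqrt (1 / pi^2 + 1 / 16) <= 41 / 100 because pi >= 3.1. *)
Lemma weights_le (t b u v : R) : 0 < t < 1 -> 0 <= b ->
  u ^+ 2 + v ^+ 2 <= (t * b) ^+ 2 ->
  `|bweight t * u + 2 * (1 - t) * v| <= 2 * (41 / 100 * b).
Proof.
move=> t01 b0 uv; have /andP[w0 w1] := bweight_bounds t01.
have p31 := @pi_ge31 R; have p0 := pi_gt0 R.
have b0' : 0 <= 2 * (41 / 100 * b) by lra.
rewrite -(@ler_pXn2r _ 2)// ?nnegrE// real_normK ?num_real//.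
set w := bweight t in w0 w1 *.
have wt0 : 0 <= w * t by rewrite mulr_ge0//; case/andP : t01 => /ltW.
have wt : w * t <= 20 / 31.
  case/andP : t01 => t0 _; rewrite -ler_pdivlMr// (le_trans w1)//.
  rewrite invfM mulrA ler_pM2r ?invr_gt0//.
  by rewrite ler_pdivrMr//; lra.
have qt0 : 0 <= t * (1 - t) by case/andP : t01 => t0 t1; rewrite mulr_ge0//; lra.
have qt : t * (1 - t) <= 1 / 4 by have := sqr_ge0 (t - 1 / 2); lra.
have wt2 : (w * t) ^+ 2 <= (20 / 31) ^+ 2 by rewrite ler_pXn2r// nnegrE; lra.
have qt2 : (t * (1 - t)) ^+ 2 <= (1 / 4) ^+ 2 by rewrite ler_pXn2r// nnegrE; lra.
apply: (@le_trans _ _ ((w ^+ 2 + 4 * (1 - t) ^+ 2) * (u ^+ 2 + v ^+ 2))).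
  by have := sqr_ge0 (w * v - 2 * (1 - t) * u); lra.
apply: (@le_trans _ _ ((w ^+ 2 + 4 * (1 - t) ^+ 2) * (t * b) ^+ 2)).
  by rewrite ler_wpM2l// addr_ge0 ?sqr_ge0// mulr_ge0 ?sqr_ge0.
rewrite (_ : _ * _ = ((w * t) ^+ 2 + 4 * (t * (1 - t)) ^+ 2) * b ^+ 2); last by ring.
rewrite (_ : (2 * _) ^+ 2 = (2 * (41 / 100)) ^+ 2 * b ^+ 2); last by ring.
by rewrite ler_wpM2r ?sqr_ge0//; lra.
Qed.

(** Sandwich the indicator of v <= x between the two Beurling functions at
    T (x - v), for the law and for the Gaussian law alike.  The two distribution
    functions then differ by at most half of |(MH - GH) +- (MK - GK)|, plus the
    Gaussian mean GK of the Fejer kernel.  By Fourier inversion on ]0, 1[ the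
    differences of means are integrals of the difference of the characteristic
    functions against the kernel weights; this is where the hypothesis enters. *)
Lemma smoothing s (T x : R) (b : R -> R) : is_law s -> 0 < T ->
  mu.-integrable `]0, 1[ (EFin \o b) -> (forall t, 0 < t < 1 -> 0 <= b t) ->
  (forall t, 0 < t < 1 ->
    (lmean s (fun v => cos (t * T * v)) - expR (- (2^-1 * (t * T) ^+ 2))) ^+ 2 +
    lmean s (fun v => sin (t * T * v)) ^+ 2 <= (t * b t) ^+ 2) ->
  `|lmean s (fun v => (v <= x)%R%:R) - normal_cdf x| <=
    41 / 100 * \int[mu]_(t in `]0, 1[) b t + Num.sqrt (2 * pi) / T.
Proof.
move=> sP T0 ib b0 hb.
have xT (y : R) : (0 <= T * (x - y)) = (y <= x) by rewrite pmulr_rge0// subr_ge0.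
have [iH GHE] := gauss_mean_bfun T x; have [iK GKE] := gauss_mean_fejer T x.
have GKle := gauss_mean_fejer_le x T0.
have [iP PE] := normal_cdfE x.
set GH := \int[mu]_y (bfun (T * (x - y)) * gpdf y) in GHE.
set GK := \int[mu]_y (fejer (T * (x - y)) * gpdf y) in GKE GKle.
pose MH := lmean s (fun v => bfun (T * (x - v))).
pose MK := lmean s (fun v => fejer (T * (x - v))).
have Mub : lmean s (fun v => (v <= x)%R%:R) <= (1 + MH + MK) / 2.
  have -> : (1 + MH + MK) / 2 = lmean s (fun v => 2^-1 * (1 + bfun (T * (x - v)) + fejer (T * (x - v)))).
    by rewrite lmeanZ !lmeanD (lmean_cst 1 sP) -/MH -/MK mulrC.
  apply: le_lmean => // v; rewrite -xT; have := bfun_majorant (T * (x - v)); lra.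
have Mlb : (1 + MH - MK) / 2 <= lmean s (fun v => (v <= x)%R%:R).
  have -> : (1 + MH - MK) / 2 = lmean s (fun v => 2^-1 * (1 + bfun (T * (x - v)) - fejer (T * (x - v)))).
    by rewrite lmeanZ lmeanB lmeanD (lmean_cst 1 sP) -/MH -/MK mulrC.
  apply: le_lmean => // v; rewrite -xT; have := bfun_minorant (T * (x - v)); lra.
have ig := @integrable_gpdf R.
have iGH := integrable_realD measurableT ig iH.
have Gub : normal_cdf x <= (1 + GH + GK) / 2.
  have -> : (1 + GH + GK) / 2 = \int[mu]_y (2^-1 * (gpdf y + bfun (T * (x - y)) * gpdf y + fejer (T * (x - y)) * gpdf y)).
    rewrite RintegralZl//; last by apply: integrable_realD.
    rewrite !RintegralD// -/GH -/GK.
    by rewrite /Rintegral integral_gpdf/=; lra.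
  rewrite PE; apply: le_Rintegral => //.
    by apply: integrable_realZ => //; exact: integrable_realD.
  move=> y _; rewrite -xT.
  by have := ler_wpM2r (gpdf_ge0 y) (bfun_majorant (T * (x - y))); lra.
have Glb : (1 + GH - GK) / 2 <= normal_cdf x.
  have -> : (1 + GH - GK) / 2 = \int[mu]_y (2^-1 * (gpdf y + bfun (T * (x - y)) * gpdf y - fejer (T * (x - y)) * gpdf y)).
    rewrite RintegralZl//; last by apply: integrable_realB.
    rewrite RintegralB// RintegralD// -/GH -/GK.
    by rewrite /Rintegral integral_gpdf/=; lra.
  rewrite PE; apply: le_Rintegral => //.
    by apply: integrable_realZ => //; exact: integrable_realB.
  move=> y _; rewrite -xT.
  by have := ler_wpM2r (gpdf_ge0 y) (bfun_minorant (T * (x - y))); lra.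
pose X t := lmean s (fun v => sin (t * (T * (x - v)))) - sin (t * T * x) * expR (- (2^-1 * (t * T) ^+ 2)).
pose Y t := lmean s (fun v => cos (t * (T * (x - v)))) - cos (t * T * x) * expR (- (2^-1 * (t * T) ^+ 2)).
have iX : mu.-integrable `]0, 1[ (EFin \o (fun t => bweight t * X t)) /\
    \int[mu]_(t in `]0, 1[) (bweight t * X t) = MH - GH.
  have E t : bweight t * X t = bweight t * lmean s (fun v => sin (t * (T * (x - v))))
      - bweight t * (sin (t * T * x) * expR (- (2^-1 * (t * T) ^+ 2))).
    by rewrite /X mulrBr.
  have i1 : mu.-integrable `]0, 1[ (EFin \o (fun t => bweight t * lmean s (fun v => sin (t * (T * (x - v)))))).
    have F t : bweight t * lmean s (fun v => sin (t * (T * (x - v)))) =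
        lmean s (fun v => bweight t * sin (t * (T * (x - v)))) by rewrite lmeanZ.
    rewrite (funext F); apply: integrable_lmean; first exact: measurable_itv.
    by move=> v; exact: integrable_bfun.
  have i2 : mu.-integrable `]0, 1[ (EFin \o (fun t => bweight t * (sin (t * T * x) * expR (- (2^-1 * (t * T) ^+ 2))))).
    apply: (@integrable_bounded01 _ _ (2 / pi * `|T * x|)).
      apply: measurable_funM; first exact: measurable_bweight.
      apply: measurable_funTS; apply: continuous_measurable_fun => t.
      apply: cvgM; last exact: continuous_expR_scale.
      by under eq_fun do rewrite -mulrA; rewrite -mulrA; exact: continuous_sinM.
    move=> t t01; apply: bweightM_bounded => //.
    rewrite normrM -mulrA; case/andP : t01 => t0 _.
    apply: le_trans (norm_sinM_le (T * x) t0).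
    rewrite ler_piMr// ger0_norm ?expR_ge0// -[leRHS]expR0 ler_expR.
    by rewrite oppr_le0 mulr_ge0 ?sqr_ge0.
  rewrite (funext E); split; first exact: integrable_realB.
  have mI : measurable (`]0, 1[%classic : set (measurableTypeR R)) by exact: measurable_itv.
  by rewrite (RintegralB mI i1 i2) -GHE -lmean_bfun.
have iY : mu.-integrable `]0, 1[ (EFin \o (fun t => 2 * (1 - t) * Y t)) /\
    \int[mu]_(t in `]0, 1[) (2 * (1 - t) * Y t) = MK - GK.
  have E t : 2 * (1 - t) * Y t = 2 * ((1 - t) * lmean s (fun v => cos (t * (T * (x - v)))))
      - 2 * ((1 - t) * (cos (t * T * x) * expR (- (2^-1 * (t * T) ^+ 2)))).
    by rewrite /Y; ring.
  have i1 : mu.-integrable `]0, 1[ (EFin \o (fun t => (1 - t) * lmean s (fun v => cos (t * (T * (x - v)))))).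
    have F t : (1 - t) * lmean s (fun v => cos (t * (T * (x - v)))) =
        lmean s (fun v => (1 - t) * cos (t * (T * (x - v)))) by rewrite lmeanZ.
    rewrite (funext F); apply: integrable_lmean; first exact: measurable_itv.
    by move=> v; exact: integrable_fejer.
  have i2 : mu.-integrable `]0, 1[ (EFin \o (fun t => (1 - t) * (cos (t * T * x) * expR (- (2^-1 * (t * T) ^+ 2))))).
    apply: integrable_continuous01 => t; apply: cvgM.
      by apply: cvgB; [exact: cvg_cst|exact: cvg_id].
    apply: cvgM; last exact: continuous_expR_scale.
    by under eq_fun do rewrite -mulrA; rewrite -mulrA; exact: continuous_cosM.
  have mI : measurable (`]0, 1[%classic : set (measurableTypeR R)) by exact: measurable_itv.
  have j1 := integrable_realZ mI 2 i1.
  have j2 := integrable_realZ mI 2 i2.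
  rewrite (funext E); split; first exact: integrable_realB.
  by rewrite (RintegralB mI j1 j2) (RintegralZl 2 mI i1) (RintegralZl 2 mI i2) -GKE -lmean_fejer.
(* (X, Y) is a rotation by t T x of the difference of the characteristic functions *)
have XY t : 0 < t < 1 -> X t ^+ 2 + Y t ^+ 2 <= (t * b t) ^+ 2.
  move=> t01; apply: le_trans (hb t t01).
  rewrite /X /Y.
  under eq_lmean do rewrite sinB_scale.
  under [in lmean s (fun v => cos _)]eq_lmean do rewrite cosB_scale.
  rewrite lmeanB lmeanD !lmeanZ.
  have := cos2Dsin2 (t * T * x).
  move: (cos (t * T * x)) (sin (t * T * x)) (lmean s (fun v => cos (t * T * v)))
    (lmean s (fun v => sin (t * T * v))) (expR _) => C S c sn e CS.
  have -> : (S * c - C * sn - S * e) ^+ 2 + (C * c + S * sn - C * e) ^+ 2 =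
     (C ^+ 2 + S ^+ 2) * ((c - e) ^+ 2 + sn ^+ 2) by ring.
  by rewrite CS mul1r.
have [iX1 iX2] := iX; have [iY1 iY2] := iY.
have ib2 : mu.-integrable `]0, 1[ (EFin \o (fun t => 2 * (41 / 100 * b t))).
  by apply: integrable_realZ => //; exact: integrable_realZ.
have D (e : R) : `|e| = 1 -> `|(MH - GH) + e * (MK - GK)| <= 2 * (41 / 100 * \int[mu]_(t in `]0, 1[) b t).
  move=> e1; rewrite -iX2 -iY2.
  rewrite -[e * _]RintegralZl// -RintegralD//; last exact: integrable_realZ.
  rewrite -[41 / 100 * _]RintegralZl// -[2 * \int[mu]_(t in _) _]RintegralZl//; last exact: integrable_realZ.
  have iXY : mu.-integrable `]0, 1[ (EFin \o (fun t => bweight t * X t + e * (2 * (1 - t) * Y t))).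
    by apply: integrable_realD => //; exact: integrable_realZ.
  apply: (le_trans (le_normr_Rintegral _ iXY)) => //.
  apply: le_Rintegral => //; first exact: (integrable_norm iXY).
  move=> t; rewrite /= in_itv/= => t01.
  rewrite mulrCA; apply: weights_le; [exact: t01|exact: b0|].
  have -> : (e * Y t) ^+ 2 = Y t ^+ 2 by rewrite exprMn -[e ^+ 2]real_normK ?num_real// e1 expr1n mul1r.
  exact: XY.
have := D 1 (normr1 _); have := D (-1) (normrN1 _); rewrite mul1r mulN1r.
clear - Mub Mlb Gub Glb GKle; clearbody MH MK GH GK.
move: (lmean _ _) (normal_cdf x) (\int[mu]_(t in _) b t) (_ / T) Mub Mlb Gub Glb GKle.
move=> P F I V h1 h2 h3 h4 h5; rewrite !ler_norml => /andP[? ?] /andP[? ?].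
by apply/andP; split; lra.
Qed.

End smoothing.

(** * Characteristic functions near a Gaussian *)

Section moments.
Context {R : realType}.
Implicit Types (s : seq (R * R)) (t : R).

Definition centered s := lmean s id = 0.
Definition mom2 s : R := lmean s (fun v => v ^+ 2).
Definition mom3 s : R := lmean s (fun v => `|v| ^+ 3).

Lemma mom2_ge0 s : is_law s -> 0 <= mom2 s.
Proof. by move=> sP; apply: lmean_ge0 => // v; exact: sqr_ge0. Qed.

Lemma mom3_ge0 s : is_law s -> 0 <= mom3 s.
Proof. by move=> sP; apply: lmean_ge0 => // v; exact: exprn_ge0. Qed.

(** Lyapunov's inequality: integrate the bound
    |v|^3 >= (3/2) u v^2 - u^3/2, tangent at |v| = u, for u^2 the second moment. *)
Lemma mom2_mom3 s : is_law s -> Num.sqrt (mom2 s) ^+ 3 <= mom3 s.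
Proof.
move=> sP; have m0 := mom2_ge0 sP.
set u := Num.sqrt _; have u0 : 0 <= u by exact: sqrtr_ge0.
have u2 : u ^+ 2 = mom2 s by rewrite sqr_sqrtr.
have h : lmean s (fun v => 3 / 2 * u * v ^+ 2 - u ^+ 3 / 2) <= mom3 s.
  apply: le_lmean => // v; rewrite -[v ^+ 2]real_normK ?num_real//.
  have v0 := normr_ge0 v.
  have w0 : 0 <= `|v| + u / 2 by lra.
  by have := mulr_ge0 (sqr_ge0 (`|v| - u)) w0; lra.
apply: le_trans h; rewrite lmeanB lmeanZ (lmean_cst _ sP) -/(mom2 s) -u2.
lra.
Qed.

(** The triangle inequality for the mean of the planar vector (a, b): take the
    scalar product with the direction of the mean. *)
Lemma lmean_norm2 s (a b c : R -> R) : is_law s -> (forall v, 0 <= c v) ->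
  (forall v, a v ^+ 2 + b v ^+ 2 <= c v ^+ 2) ->
  lmean s a ^+ 2 + lmean s b ^+ 2 <= lmean s c ^+ 2.
Proof.
move=> sP c0 abc; set A := lmean s a; set B := lmean s b.
pose r := Num.sqrt (A ^+ 2 + B ^+ 2).
have AB0 : 0 <= A ^+ 2 + B ^+ 2 by rewrite addr_ge0 ?sqr_ge0.
have r0 : 0 <= r by exact: sqrtr_ge0.
have r2 : r ^+ 2 = A ^+ 2 + B ^+ 2 by rewrite sqr_sqrtr.
have h : A * A + B * B <= r * lmean s c.
  rewrite -!lmeanZ -lmeanD; apply: le_lmean => // v.
  have rc0 : 0 <= r * c v by rewrite mulr_ge0.
  rewrite (le_trans (ler_norm _))// -(ger0_norm rc0) -ler_sqr ?nnegrE// !real_normK ?num_real//.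
  rewrite exprMn r2.
  have h1 := ler_wpM2l AB0 (abc v).
  by have := sqr_ge0 (A * b v - B * a v); lra.
have m0 : 0 <= lmean s c by exact: lmean_ge0.
have [r00|rn0] := eqVneq r 0.
  by rewrite -r2 r00 expr0n/= sqr_ge0.
have rp : 0 < r by rewrite lt0r rn0.
have : r <= lmean s c.
  by rewrite -(ler_pM2l rp) -expr2 r2; move: h; rewrite -!expr2.
by rewrite -r2 ler_pXn2r// nnegrE.
Qed.

End moments.

Section characteristic_functions.
Context {R : realType}.
Implicit Types (s : seq (R * R)) (t : R) (z : R[i]).
Local Notation normc := (@Normc.normc R).

Definition chf s t : R[i] :=
  Complex (lmean s (fun v => cos (t * v))) (lmean s (fun v => sin (t * v))).

Lemma normc_sqr z : normc z ^+ 2 = complex.Re z ^+ 2 + complex.Im z ^+ 2.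
Proof. by case: z => a b /=; rewrite sqr_sqrtr// addr_ge0 ?sqr_ge0. Qed.

Lemma normc_ge0 z : 0 <= normc z.
Proof. by case: z => a b; exact: sqrtr_ge0. Qed.

Lemma normc_le z (e : R) : 0 <= e ->
  complex.Re z ^+ 2 + complex.Im z ^+ 2 <= e ^+ 2 -> normc z <= e.
Proof.
by move=> e0; rewrite -normc_sqr ler_pXn2r// nnegrE normc_ge0.
Qed.

Lemma normc_realB (a b : R) : normc (a%:C%C - b%:C%C) = `|a - b|.
Proof. by rewrite /= subr0 expr0n/= addr0 sqrtr_sqr. Qed.

Lemma chf_taylor2 s t : is_law s -> centered s ->
  normc (chf s t - (1 - 2^-1 * (t ^+ 2 * mom2 s))%:C%C) <= `|t| ^+ 3 * mom3 s / 6.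
Proof.
move=> sP s0; have e0 : 0 <= `|t| ^+ 3 * mom3 s / 6.
  by rewrite divr_ge0// mulr_ge0 ?mom3_ge0// exprn_ge0.
apply: normc_le => //=.
rewrite subr0.
pose a v : R := cos (t * v) - 1 + 2^-1 * (t * v) ^+ 2.
pose b v : R := sin (t * v) - t * v.
pose c v : R := 6^-1 * `|t * v| ^+ 3.
have aE : lmean s (fun v => cos (t * v)) - (1 - 2^-1 * (t ^+ 2 * mom2 s)) = lmean s a.
  rewrite /a lmeanD lmeanB lmeanZ (lmean_cst 1 sP).
  rewrite (@eq_lmean _ s (fun v => (t * v) ^+ 2) (fun v => t ^+ 2 * v ^+ 2)); last first.
    by move=> v; rewrite exprMn.
  by rewrite lmeanZ -/(mom2 s); ring.
have bE : lmean s (fun v => sin (t * v)) = lmean s b.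
  by rewrite /b lmeanB lmeanZ (s0 : lmean s (fun v => v) = 0) mulr0 subr0.
have cE : `|t| ^+ 3 * mom3 s / 6 = lmean s c.
  rewrite /c lmeanZ.
  rewrite (@eq_lmean _ s (fun v => `|t * v| ^+ 3) (fun v => `|t| ^+ 3 * `|v| ^+ 3)); last first.
    by move=> v; rewrite normrM exprMn.
  by rewrite lmeanZ mulrC.
rewrite aE bE cE; apply: lmean_norm2 => //.
- by move=> v; rewrite /c mulr_ge0.
- by move=> v; exact: taylor2_expi.
Qed.

(** Each cross term is a product of a function of v and a function of w, one of
    which is the identity.  Averaged over two independent copies of a centered
    law they vanish, so E|Y - Y'|^3 <= 4 E|Y|^3. *)
Lemma cube_sub_le (v w : R) : `|v - w| ^+ 3 <=
  2 * `|v| ^+ 3 + 2 * `|w| ^+ 3 - 2 * (w * (v * `|v|)) - 2 * (v * (w * `|w|)).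
Proof.
have h := mulr_ge0 (normr_ge0 (v - w)) (normr_ge0 (v - w)).
have v0 := normr_ge0 v; have w0 := normr_ge0 w.
have h1 : `|v - w| ^+ 3 <= (v - w) ^+ 2 * (`|v| + `|w|).
  rewrite -[(v - w) ^+ 2]real_normK ?num_real// [leLHS]exprSr.
  by rewrite ler_wpM2l ?sqr_ge0// ler_normB.
have h2 : 0 <= (`|v| + `|w|) * (`|v| - `|w|) ^+ 2.
  by rewrite mulr_ge0 ?addr_ge0 ?sqr_ge0.
apply: (le_trans h1).
rewrite sqrrB -[v ^+ 2]real_normK ?num_real// -[w ^+ 2]real_normK ?num_real//.
by rewrite -mulr_natl; lra.
Qed.

Lemma normc_chf_sqr s t : normc (chf s t) ^+ 2 =
  lmean s (fun v => lmean s (fun w => cos (t * (v - w)))).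
Proof.
rewrite normc_sqr /= !expr2 -!lmeanZ -lmeanD.
apply: eq_lmean => v; rewrite mulrC [X in _ + X]mulrC -!lmeanZ -lmeanD.
by apply: eq_lmean => w; rewrite mulrBr cosB.
Qed.

(** The squared modulus is the mean of cos (t (Y - Y')) for an independent copy
    Y' of Y.  Apply [cos_le_cubic] and then [cube_sub_le]. *)
Lemma normc_chf_le s t : is_law s -> centered s ->
  normc (chf s t) ^+ 2 <= 1 - t ^+ 2 * mom2 s + 44 / 100 * (`|t| ^+ 3 * mom3 s).
Proof.
move=> sP s0; rewrite normc_chf_sqr.
pose F v w : R := 1 - 2^-1 * t ^+ 2 * (v ^+ 2 + w ^+ 2 - 2 * v * w)
  + 22 / 100 * `|t| ^+ 3 * (`|v| ^+ 3 + `|w| ^+ 3 - (v * `|v|) * w - v * (w * `|w|)).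
pose A := lmean s (fun w => w * `|w|).
have FE v : lmean s (F v) = 1 - 2^-1 * t ^+ 2 * (v ^+ 2 + mom2 s)
    + 22 / 100 * `|t| ^+ 3 * (`|v| ^+ 3 + mom3 s - v * A).
  rewrite /F lmeanD lmeanB (lmean_cst 1 sP) !lmeanZ lmeanB lmeanD (lmean_cst _ sP).
  rewrite lmeanZ -/(mom2 s) (s0 : lmean s (fun v => v) = 0) mulr0 subr0.
  rewrite !lmeanB lmeanD (lmean_cst _ sP) -/(mom3 s) !lmeanZ -/A.
  by rewrite (s0 : lmean s (fun v => v) = 0) mulr0 subr0.
apply: (@le_trans _ _ (lmean s (fun v => lmean s (F v)))).
  apply: le_lmean => // v; apply: le_lmean => // w.
  apply: (le_trans (cos_le_cubic _)); rewrite /F normrM !exprMn.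
  have t3 : 0 <= `|t| ^+ 3 by exact: exprn_ge0.
  by have := ler_wpM2l t3 (cube_sub_le v w); lra.
under eq_lmean do rewrite FE.
rewrite lmeanD lmeanB (lmean_cst 1 sP) !lmeanZ lmeanD (lmean_cst _ sP) -/(mom2 s).
rewrite lmeanB lmeanD (lmean_cst _ sP) -/(mom3 s).
have -> : lmean s (fun v => v * A) = 0.
  by under eq_lmean do rewrite mulrC; rewrite lmeanZ (s0 : lmean s (fun v => v) = 0) mulr0.
by lra.
Qed.

Lemma normc_chf_le_expR s t : is_law s -> centered s -> 0 <= t ->
  normc (chf s t) <= expR (- (2^-1 * (t ^+ 2 * mom2 s)) + 22 / 100 * (t ^+ 3 * mom3 s)).
Proof.
move=> sP s0 t0; rewrite -(@ler_pXn2r _ 2)// ?nnegrE ?normc_ge0 ?expR_ge0//.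
apply: (le_trans (normc_chf_le t sP s0)); rewrite ger0_norm//.
rewrite [leRHS]expr2 -expRD; apply: le_trans (expR_ge1Dx _); lra.
Qed.

(** Compare both sides with 1 - u^2/2, where u = t * sqrt (mom2 s): the errors are
    1/6 and 0.155 times t^3 mom3.  [expR_removal] then restores the exponential
    factor, and (1/6 + 0.155) * 1.47 <= 0.473.  The factor must be the bound of
    [normc_chf_le_expR], so that a telescoping product loses nothing. *)
Lemma chf_gauss_diff s t : is_law s -> centered s -> 0 <= t ->
  normc (chf s t - (expR (- (2^-1 * (t ^+ 2 * mom2 s))))%:C%C) <=
  473 / 1000 * (t ^+ 3 * mom3 s) *
    expR (- (2^-1 * (t ^+ 2 * mom2 s)) + 22 / 100 * (t ^+ 3 * mom3 s)).
Proof.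
move=> sP s0 t0.
pose u := t * Num.sqrt (mom2 s).
have u0 : 0 <= u by rewrite mulr_ge0 ?sqrtr_ge0.
have u2 : t ^+ 2 * mom2 s = u ^+ 2 by rewrite exprMn sqr_sqrtr// mom2_ge0.
have u3 : u ^+ 3 <= t ^+ 3 * mom3 s.
  by rewrite exprMn ler_wpM2l ?exprn_ge0// mom2_mom3.
have h1 := chf_taylor2 t sP s0; rewrite ger0_norm// u2 in h1.
rewrite u2; set l := t ^+ 3 * mom3 s in u3 h1 *.
have l0 : 0 <= l by apply: le_trans u3; exact: exprn_ge0.
have h2 : normc ((1 - 2^-1 * u ^+ 2)%:C%C - (expR (- (2^-1 * u ^+ 2)))%:C%C) <= 155 / 1000 * u ^+ 3.
  have e1 := expR_ge1Dx (- (2^-1 * u ^+ 2)).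
  have e2 := expRN_sqr_half u0.
  rewrite (_ : u ^+ 2 / 2 = 2^-1 * u ^+ 2) in e2; last by rewrite mulrC.
  rewrite normc_realB distrC ger0_norm; last by lra.
  by lra.
have h3 : normc (chf s t - (expR (- (2^-1 * u ^+ 2)))%:C%C) <= (1 / 6 + 155 / 1000) * l.
  rewrite -(subrK (1 - 2^-1 * u ^+ 2)%:C%C (chf s t)) -addrA.
  by apply: (le_trans (le_normcD _ _)); lra.
apply: (le_trans h3).
have h4 : expR (u ^+ 2 / 2 - 22 / 100 * l) <= 147 / 100.
  by apply: le_trans (expR_removal u0); rewrite ler_expR; lra.
rewrite (_ : - _ + _ = - (u ^+ 2 / 2 - 22 / 100 * l)); last by lra.
rewrite expRN ler_pdivlMr ?expR_gt0//.
have := ler_wpM2l l0 h4; lra.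
Qed.

(** Replace the factors one at a time; E j bounds both the j-th factor and its
    substitute, and the error d j is relative to E j. *)
Lemma normc_prodB n (a b : nat -> R[i]) (E d : nat -> R) :
  (forall j, (j < n)%N -> normc (a j) <= E j) ->
  (forall j, (j < n)%N -> normc (b j) <= E j) ->
  (forall j, (j < n)%N -> normc (a j - b j) <= d j * E j) ->
  normc (\prod_(j < n) a j - \prod_(j < n) b j) <=
    (\sum_(j < n) d j) * \prod_(j < n) E j.
Proof.
elim: n => [|n IHn] aE bE dE.
  by rewrite !big_ord0 subrr Normc.normc0 mul0r.
have {}IHn := IHn (fun j jn => aE j (ltnW jn)) (fun j jn => bE j (ltnW jn)) (fun j jn => dE j (ltnW jn)).
have bP : normc (\prod_(j < n) b j) <= \prod_(j < n) E j.
  elim: n {IHn aE dE} bE => [|m IHm] bE; first by rewrite !big_ord0 Normc.normc1.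
  rewrite !big_ord_recr/= Normc.normcM ler_pM ?normc_ge0//; last exact: bE.
  by apply: IHm => j jm; apply: bE; exact: ltnW.
rewrite !big_ord_recr/=.
set A := \prod_(j < n) a j; set B := \prod_(j < n) b j in bP *.
rewrite -/A -/B in IHn.
have -> : A * a n - B * b n = (A - B) * a n + B * (a n - b n) by ring.
apply: (le_trans (le_normcD _ _)); rewrite !Normc.normcM mulrDl.
apply: lerD.
  by rewrite mulrA ler_pM ?normc_ge0// aE.
by rewrite [leRHS]mulrCA ler_pM ?normc_ge0// dE.
Qed.

End characteristic_functions.

(** * A Berry-Esseen bound with constant 2.75 *)

Section berry_esseen.
Context {R : realType}.
Notation mu := (@lebesgue_measure R).
Local Notation normc := (@Normc.normc R).
Implicit Types (T L k x : R).

(** Add the tangent inequalities at the barycenter. *)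
Lemma expR_convex (a b r : R) : 0 <= r <= 1 ->
  expR ((1 - r) * a + r * b) <= (1 - r) * expR a + r * expR b.
Proof.
move=> /andP[r0 r1]; set m := (1 - r) * a + r * b.
have h (c : R) : expR m * (1 + (c - m)) <= expR c.
  rewrite -[in leRHS](subrK m c) [leRHS]expRD mulrC ler_wpM2r ?expR_ge0//.
  exact: expR_ge1Dx.
have r1' : 0 <= 1 - r by lra.
have h1 := ler_wpM2l r1' (h a); have h2 := ler_wpM2l r0 (h b).
apply: le_trans (lerD h1 h2).
by rewrite le_eqVlt; apply/orP; left; apply/eqP; rewrite /m; ring.
Qed.

Lemma sqrt_2pi_le : Num.sqrt (2 * pi) <= 252 / 100 :> R.
Proof.
have h := @pi_le317 R; have p0 := pi_gt0 R.
have c0 : (0 : R) <= 252 / 100 by lra.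
rewrite -(ger0_norm c0) -sqrtr_sqr ler_wsqrtr//; lra.
Qed.

Lemma normal_cdf01 x : 0 <= normal_cdf x <= 1.
Proof.
have [ix ->] := normal_cdfE x; apply/andP; split.
  by apply: Rintegral_ge0 => y _; rewrite mulr_ge0 ?gpdf_ge0.
rewrite [leRHS](_ : (1 : R) = \int[mu]_y gpdf y); last by rewrite /Rintegral integral_gpdf.
apply: le_Rintegral; [exact: measurableT|exact: ix|exact: integrable_gpdf|].
by move=> y _; case: (y <= x); rewrite ?mul1r ?mul0r ?gpdf_ge0.
Qed.

Lemma is_derive_expR_scale T k (t : R) :
  is_derive t 1 (fun t : R => expR (- (k * (t * T) ^+ 2)))
    (- (2 * k * T ^+ 2 * t) * expR (- (k * (t * T) ^+ 2))).
Proof.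
by apply: is_derive_eq; rewrite /GRing.scale/=; move: (expR _) => e; ring.
Qed.

Let gk T k (j : nat) t : R := T ^+ 3 * t ^+ j * expR (- (k * (t * T) ^+ 2)).

Let continuous_gk T k j : continuous (gk T k j).
Proof.
move=> t; apply: cvgM; last exact: continuous_expR_scale.
by apply: cvgM; [exact: cvg_cst|exact: exprn_continuous].
Qed.

(** Integrating by parts turns t^2 e^{- (t T)^2 / 2} into the Gaussian integral of
    [gpdf_half_mass] and a boundary term of favourable sign. *)
Lemma Rintegral01_gauss2 T : 0 < T ->
  \int[mu]_(t in `]0, 1[) (T ^+ 3 * t ^+ 2 * expR (- (2^-1 * (t * T) ^+ 2)))
    <= Num.sqrt (2 * pi) / 2.
Proof.
move=> T0; rewrite -/(gk T 2^-1 2 _).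
have FE (t : R) : is_derive t 1 (fun t => T * t * expR (- (2^-1 * (t * T) ^+ 2)))
    (T * expR (- (2^-1 * (t * T) ^+ 2)) - gk T 2^-1 2 t).
  have d := is_derive_expR_scale T 2^-1 t.
  apply: is_derive_eq; rewrite /GRing.scale/= /gk.
  by move: (expR _) => e; field.
have mI : measurable (`]0, 1[%classic : set (measurableTypeR R)) by exact: measurable_itv.
have i1 : mu.-integrable `]0, 1[ (EFin \o (fun t => expR (- (2^-1 * (t * T) ^+ 2)))).
  by apply: integrable_continuous01; exact: continuous_expR_scale.
have i2 : mu.-integrable `]0, 1[ (EFin \o gk T 2^-1 2).
  by apply: integrable_continuous01; exact: continuous_gk.
have cF : continuous (fun t : R => T * expR (- (2^-1 * (t * T) ^+ 2)) - gk T 2^-1 2 t).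
  move=> t; apply: cvgB; last exact: continuous_gk.
  by apply: cvgM; [exact: cvg_cst|exact: continuous_expR_scale].
have := Rintegral01_derive FE cF.
rewrite (RintegralB mI (integrable_realZ mI T i1) i2) (RintegralZl T mI i1).
rewrite mulr0 mul0r subr0 mulr1 => h.
have h1 := gpdf_half_mass T0.
have h2 : T * \int[mu]_(t in `]0, 1[) expR (- (2^-1 * (t * T) ^+ 2)) <= Num.sqrt (2 * pi) / 2.
  rewrite mulrC -ler_pdivlMr//; apply: le_trans h1 _.
  by rewrite invfM mulrA.
have h3 : 0 <= T * expR (- (2^-1 * (1 * T) ^+ 2)).
  by apply: mulr_ge0; [exact: ltW|exact: expR_ge0].
lra.
Qed.

Lemma Rintegral01_gauss3 T k : 0 < T -> 0 < k ->
  \int[mu]_(t in `]0, 1[) (T ^+ 3 * t ^+ 3 * expR (- (k * (t * T) ^+ 2)))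
    <= (2 * k ^+ 2 * T)^-1.
Proof.
move=> T0 k0; have Tn := lt0r_neq0 T0; have kn := lt0r_neq0 k0.
pose c := (2 * k * T)^-1.
have FE (t : R) : is_derive t 1
    (fun t => (c * (T ^+ 2 * t ^+ 2 + k^-1)) * - expR (- (k * (t * T) ^+ 2))) (gk T k 3 t).
  have d := is_derive_expR_scale T k t.
  apply: is_derive_eq; rewrite /GRing.scale/= /gk /c.
  by move: (expR _) => e; field; rewrite Tn kn.
rewrite -/(gk T k 3 _) (Rintegral01_derive FE (@continuous_gk _ _ _)).
have e0 := expR_ge0 (- (k * (1 * T) ^+ 2)).
have c0 : 0 <= c * (T ^+ 2 * 1 ^+ 2 + k^-1).
  apply: mulr_ge0; first by rewrite invr_ge0 ltW// mulr_gt0// mulr_gt0.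
  by apply: addr_ge0; [apply: mulr_ge0; exact: sqr_ge0|rewrite invr_ge0 ltW].
have h := mulr_ge0 c0 e0.
rewrite mul0r !expr0n/= mulr0 add0r mulr0 oppr0 expR0 /c.
rewrite (_ : (2 * k ^+ 2 * T)^-1 = c * k^-1); last by rewrite /c; field; rewrite Tn kn.
by rewrite -/c; lra.
Qed.

(** With unit total variance, the Gaussian factors multiply to e^{- s^2 / 2} and
    the moduli of the factors to the same function up to the cubic correction. *)
Lemma chf_prod_gauss (Y : nat -> seq (R * R)) n (s : R) :
  (forall j, (j < n)%N -> is_law (Y j)) -> (forall j, (j < n)%N -> centered (Y j)) ->
  \sum_(j < n) mom2 (Y j) = 1 -> 0 <= s ->
  normc (\prod_(j < n) chf (Y j) s - (expR (- (2^-1 * s ^+ 2)))%:C%C) <=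
  473 / 1000 * (s ^+ 3 * \sum_(j < n) mom3 (Y j)) *
    expR (- (2^-1 * s ^+ 2) + 22 / 100 * (s ^+ 3 * \sum_(j < n) mom3 (Y j))).
Proof.
move=> YP Y0 Y2 s0.
pose q j := - (2^-1 * (s ^+ 2 * mom2 (Y j))).
pose l j := 22 / 100 * (s ^+ 3 * mom3 (Y j)).
have qE : \prod_(j < n) (expR (q j))%:C%C = (expR (- (2^-1 * s ^+ 2)))%:C%C :> R[i].
  rewrite -rmorph_prod; congr (_%:C%C); rewrite -expR_sum; congr expR.
  by rewrite /q sumrN -!mulr_sumr Y2 mulr1.
rewrite -qE; apply: (le_trans (@normc_prodB _ n (fun j => chf (Y j) s) (fun j => (expR (q j))%:C%C)
  (fun j => expR (q j + l j)) (fun j => 473 / 1000 * (s ^+ 3 * mom3 (Y j))) _ _ _)).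
- by move=> j jn; apply: normc_chf_le_expR; [exact: YP|exact: Y0|].
- move=> j jn; rewrite -[_%:C%C]subr0 -[0]/(0%:C)%C normc_realB subr0 ger0_norm ?expR_ge0//.
  by rewrite ler_expR lerDl /l !mulr_ge0 ?exprn_ge0// mom3_ge0//; exact: YP.
- by move=> j jn; apply: chf_gauss_diff; [exact: YP|exact: Y0|].
rewrite -expR_sum big_split/= -/(q _) /q /l sumrN -!mulr_sumr Y2 mulr1.
exact: lexx.
Qed.

(** The Lyapunov fraction L may be assumed at most 4/11, since otherwise the right
    side is at least 1.  Cut off at T = 7 / (5 L).  At frequency t T the cubic
    correction 0.22 (t T)^3 L equals 0.308 t (t T)^2, so convexity of the
    exponential splits the bound of [chf_prod_gauss] into a Gaussian and t times a
    Gaussian with exponent 0.5 - 0.308 = 0.192.  Their integrals are at most 1.26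
    and 3.524, and
    0.41 * 0.473 * 4.784 + 2.52 / 1.4 <= 2.75. *)
Theorem berry_esseen (Y : nat -> seq (R * R)) n (w : seq (R * R)) x :
  (forall j, (j < n)%N -> is_law (Y j)) -> (forall j, (j < n)%N -> centered (Y j)) ->
  \sum_(j < n) mom2 (Y j) = 1 -> is_law w ->
  (forall t, chf w t = \prod_(j < n) chf (Y j) t) ->
  `|lmean w (fun v => (v <= x)%R%:R) - normal_cdf x| <=
    275 / 100 * \sum_(j < n) mom3 (Y j).
Proof.
move=> YP Y0 Y2 wP wE.
set L := \sum_(j < n) mom3 (Y j).
have Y3 (j : 'I_n) : 0 <= mom3 (Y j) by apply: mom3_ge0; exact: YP.
have L0 : 0 < L.
  rewrite lt0r sumr_ge0 ?andbT//; apply/eqP => /eqP; rewrite psumr_eq0// => /allP L0.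
  have : \sum_(j < n) mom2 (Y j) = 0.
    apply: big1 => j _; have := mom2_mom3 (YP j (ltn_ord j)).
    have /eqP -> := L0 j (mem_index_enum j).
    have := sqrtr_ge0 (mom2 (Y j)); rewrite le0r => /orP[/eqP s0 _|s0].
      by apply/eqP; rewrite eq_le mom2_ge0 ?andbT -?sqrtr_eq0 ?s0//; exact: YP.
    by rewrite leNgt exprn_gt0.
  by rewrite Y2 => /eqP; rewrite oner_eq0.
have [Lbig|/ltW Lsmall] := leP (4 / 11) L.
  have P0 : 0 <= lmean w (fun v => (v <= x)%R%:R) by apply: lmean_ge0.
  have P1 : lmean w (fun v => (v <= x)%R%:R) <= 1.
    by rewrite -[leRHS](lmean_cst 1 wP); apply: le_lmean => // v; case: (v <= x).
  have /andP[F0 F1] := normal_cdf01 x.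
  rewrite ler_norml; apply/andP; split; lra.
(* the smoothing cost 2.52 / T and the decay lost to the cubic term, which grows
   with L T, balance near L T = 1.4 *)
pose T := 7 / (5 * L).
have T0 : 0 < T by rewrite divr_gt0//; lra.
have LT : L * T = 7 / 5 by rewrite /T; field; rewrite lt0r_neq0.
pose g k (j : nat) t := T ^+ 3 * t ^+ j * expR (- (k * (t * T) ^+ 2)).
have cg k j : continuous (g k j).
  move=> t; apply: cvgM; last exact: continuous_expR_scale.
  by apply: cvgM; [exact: cvg_cst|exact: exprn_continuous].
have ig k j : mu.-integrable `]0, 1[ (EFin \o g k j).
  exact: integrable_continuous01.
pose b t := 473 / 1000 * L * (g 2^-1 2%N t + g (192 / 1000) 3%N t).
have ib : mu.-integrable `]0, 1[ (EFin \o b).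
  apply: integrable_realZ => //; exact: integrable_realD.
have g0 k j t : 0 < t < 1 -> 0 <= g k j t.
  by move=> /andP[/ltW t0 _]; rewrite /g mulr_ge0 ?expR_ge0// mulr_ge0 ?exprn_ge0// ltW.
have b0 t : 0 < t < 1 -> 0 <= b t.
  move=> t01; apply: mulr_ge0; first by apply: mulr_ge0; [lra|exact: ltW].
  by apply: addr_ge0; apply: g0.
have hb t : 0 < t < 1 ->
    (lmean w (fun v => cos (t * T * v)) - expR (- (2^-1 * (t * T) ^+ 2))) ^+ 2 +
    lmean w (fun v => sin (t * T * v)) ^+ 2 <= (t * b t) ^+ 2.
  move=> t01; have := b0 t t01; case/andP : (t01) => t0 t1 bt0.
  have tT0 : 0 <= t * T by apply: mulr_ge0; exact: ltW.
  have tb0 : 0 <= t * b t by apply: mulr_ge0; [exact: ltW|exact: bt0].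
  have -> : (lmean w (fun v => cos (t * T * v)) - expR (- (2^-1 * (t * T) ^+ 2))) ^+ 2 +
      lmean w (fun v => sin (t * T * v)) ^+ 2 =
      normc (chf w (t * T) - (expR (- (2^-1 * (t * T) ^+ 2)))%:C%C) ^+ 2.
    by rewrite normc_sqr /= subr0.
  rewrite ler_pXn2r// ?nnegrE ?normc_ge0//.
  rewrite wE; apply: (le_trans (chf_prod_gauss YP Y0 Y2 tT0)); rewrite -/L.
  have E : - (2^-1 * (t * T) ^+ 2) + 22 / 100 * ((t * T) ^+ 3 * L) =
      (1 - t) * - (2^-1 * (t * T) ^+ 2) + t * - (192 / 1000 * (t * T) ^+ 2).
    rewrite (_ : (t * T) ^+ 3 * L = t * (t * T) ^+ 2 * (L * T)); last by ring.
    by rewrite LT; lra.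
  have c0 : 0 <= 473 / 1000 * ((t * T) ^+ 3 * L).
    apply: mulr_ge0; first by lra.
    by apply: mulr_ge0; [exact: exprn_ge0|exact: ltW].
  have t01' : 0 <= t <= 1 by rewrite !ltW.
  rewrite E; apply: (le_trans (ler_wpM2l c0 (expR_convex _ _ t01'))).
  have e0 := expR_ge0 (- (2^-1 * (t * T) ^+ 2)).
  apply: (@le_trans _ _ (473 / 1000 * ((t * T) ^+ 3 * L) *
     (expR (- (2^-1 * (t * T) ^+ 2)) + t * expR (- (192 / 1000 * (t * T) ^+ 2))))).
    by rewrite ler_wpM2l// lerD2r ler_piMl//; lra.
  rewrite le_eqVlt; apply/orP; left; apply/eqP; rewrite /b /g.
  by move: (expR _) (expR _) => e1 e2; ring.
apply: (le_trans (smoothing x wP T0 ib b0 hb)).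
have mI : measurable (`]0, 1[%classic : set (measurableTypeR R)) by exact: measurable_itv.
have iD := integrable_realD mI (ig 2^-1 2%N) (ig (192 / 1000) 3%N).
rewrite /b (RintegralZl _ mI iD) (RintegralD mI (ig _ _) (ig _ _)).
have h2 := Rintegral01_gauss2 T0.
have k0 : (0 : R) < 192 / 1000 by lra.
have h3 := Rintegral01_gauss3 T0 k0.
have TV : T^-1 = 5 / 7 * L by rewrite /T; field; rewrite lt0r_neq0.
have S0 := @sqrt_2pi_le; rewrite TV.
have kT : (2 * (192 / 1000) ^+ 2 * T)^-1 = (2 * (192 / 1000) ^+ 2)^-1 * (5 / 7 * L).
  by rewrite invfM TV.
rewrite kT in h3.
move: h2 h3; rewrite -/(g 2^-1 2%N _) -/(g (192 / 1000) 3%N _).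
move: (\int[mu]_(t in _) g 2^-1 _ t) (\int[mu]_(t in _) g (192 / 1000) _ t) => A B h2 h3.
have AB : A + B <= 4784 / 1000 by lra.
have h4 := ler_wpM2l (ltW L0) AB; have h5 := ler_wpM2l (ltW L0) S0.
clear - h4 h5 L0; lra.
Qed.

End berry_esseen.

(** * Integer random variables with finite support *)

Section integer_variables.
Context d (T : measurableType d) (R : realType) (P : probability T R).
Variable X : {RV P >-> int}.
Implicit Types (xs : seq int) (f : int -> R) (A : set int).

Definition supported_on xs := uniq xs /\ forall u, u \notin xs -> incr_pmf X u = 0.

Lemma measurable_int_preimage A : measurable (X @^-1` A).
Proof. by rewrite -[_ @^-1` _]setTI; exact: measurable_funP. Qed.

Lemma incr_pmfE u : P (X @^-1` [set u]) = (incr_pmf X u)%:E.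
Proof.
rewrite /incr_pmf fineK//; apply: fin_num_measure.
exact: measurable_int_preimage.
Qed.

Lemma measurable_int_comp f : measurable_fun [set: T] (fun w => f (X w)).
Proof.
move=> _ B mB; rewrite setTI; exact: (measurable_int_preimage (f @^-1` B)).
Qed.

(** The complement of the list is a countable union of null events, indexed by
    the encoding of [int] into [nat]. *)
Lemma supported_ae xs : supported_on xs -> {ae P, forall w, X w \in xs}.
Proof.
move=> [_ xs0].
pose F k : set T := if @unpickle int k is Some u then
  (if u \in xs then set0 else X @^-1` [set u]) else set0.
have F0 k : P.-negligible (F k).
  rewrite /F; case: (unpickle k) => [u|]; last exact: negligible_set0.
  case: ifPn => uxs; first exact: negligible_set0.
  apply/negligibleP; first exact: measurable_int_preimage.
  by have := incr_pmfE u; rewrite (xs0 u uxs).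
apply: negligibleS (negligible_bigcup F0) => w /= /negP Xw.
exists (pickle (X w)); first by [].
by rewrite /F pickleK (negbTE Xw).
Qed.

Lemma integrable_int_indic u (k : R) :
  P.-integrable [set: T] (EFin \o (fun w => k * (X w == u)%:R)).
Proof.
apply: integrable_realZ => //.
apply: measurable_bounded_integrable => //.
- by rewrite (le_lt_trans (probability_le1 P measurableT))// ltry.
- exact: (measurable_int_comp (fun v => (v == u)%:R)).
- exists 1; split; first exact: num_real.
  move=> M M1 w _; apply: le_trans (ltW M1).
  by rewrite ger0_norm ?ler0n// lern1 leq_b1.
Qed.

Lemma Rintegral_int_indic u : \int[P]_w (X w == u)%:R = incr_pmf X u.
Proof.
rewrite /Rintegral /incr_pmf; congr fine.
rewrite -(setIT (X @^-1` [set u])) -integral_indic//; last exact: measurable_int_preimage.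
apply: eq_integral => w _; rewrite indicE (_ : (w \in _) = (X w == u))//.
by apply/idP/eqP; rewrite inE.
Qed.

Lemma mean_int_indic (s : seq int) (c : int -> R) (e : int -> int) :
  P.-integrable [set: T] (EFin \o (fun w => \sum_(x <- s) c x * (X w == e x)%:R)) /\
  \int[P]_w (\sum_(x <- s) c x * (X w == e x)%:R) =
  \sum_(x <- s) c x * incr_pmf X (e x).
Proof.
elim: s => [|x s [IHi IHs]].
  split; last by rewrite big_nil; under eq_Rintegral do rewrite big_nil; rewrite Rintegral_cst// mul0r.
  rewrite (_ : _ \o _ = cst 0%E); first exact: integrable0.
  by apply/funext => w; rewrite /= big_nil.
have E w : \sum_(y <- x :: s) c y * (X w == e y)%:R =
    c x * (X w == e x)%:R + \sum_(y <- s) c y * (X w == e y)%:R by rewrite big_cons.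
rewrite (funext E); split.
  by apply: integrable_realD; [exact: measurableT|exact: integrable_int_indic|exact: IHi].
rewrite (RintegralD measurableT (integrable_int_indic (e x) (c x)) IHi) IHs big_cons.
have i1 : P.-integrable [set: T] (EFin \o (fun w => (X w == e x)%:R : R)).
  have := integrable_int_indic (e x) 1.
  by congr (_.-integrable _ _); apply/funext => w; rewrite /= mul1r.
by rewrite (RintegralZl _ measurableT i1) Rintegral_int_indic.
Qed.

Lemma mean_int xs f : supported_on xs ->
  P.-integrable [set: T] (EFin \o (fun w => f (X w))) /\
  \int[P]_w f (X w) = \sum_(u <- xs) incr_pmf X u * f u.
Proof.
move=> Xxs; have [uxs xs0] := Xxs.
have [ig Ig] := mean_int_indic xs f id.
set g := (fun w => \sum_(u <- xs) _) in ig Ig.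
under eq_bigr do rewrite mulrC.
have fg : ae_eq P setT (EFin \o (fun w => f (X w))) (EFin \o g).
  have := supported_ae Xxs; apply: filterS => w Xw _.
  rewrite /= /g (bigD1_seq (X w))//= eqxx mulr1 big1 ?addr0// => u.
  by rewrite eq_sym => /negbTE ->; rewrite mulr0.
have mf : measurable_fun [set: T] (EFin \o (fun w => f (X w))).
  by apply/measurable_EFinP; exact: measurable_int_comp.
have mg : measurable_fun [set: T] (EFin \o g) by case/integrableP : ig.
split; last by rewrite -Ig /Rintegral; congr fine; exact: ae_eq_integral.
apply/integrableP; split => //.
case/integrableP : ig => _; apply: le_lt_trans.
rewrite le_eqVlt; apply/orP; left; apply/eqP; apply: ae_eq_integral => //.
- exact: measurableT_comp.
- exact: measurableT_comp.
- by move: fg; apply: filterS => w h hw; have := h hw; rewrite /= => -[->].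
Qed.

Lemma expectation_int xs f : supported_on xs ->
  fine 'E_P[fun w => f (X w)] = \sum_(u <- xs) incr_pmf X u * f u.
Proof.
by move=> Xxs; rewrite -(mean_int f Xxs).2 expectation.unlock.
Qed.

Lemma incr_pmf_ge0 u : 0 <= incr_pmf X u.
Proof. by apply: fine_ge0; exact: measure_ge0. Qed.

Lemma incr_pmf_sum1 xs : supported_on xs -> \sum_(u <- xs) incr_pmf X u = 1.
Proof.
move=> Xxs; have := (mean_int (cst 1) Xxs).2.
rewrite Rintegral_cst//= probability_setT mulr1 => ->.
by apply: eq_bigr => u _; rewrite mulr1.
Qed.

Lemma prob_int xs (A : pred int) : supported_on xs ->
  fine (P (X @^-1` [set u | A u])) = \sum_(u <- xs) incr_pmf X u * (A u)%:R.
Proof.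
move=> Xxs; rewrite -(mean_int (fun u => (A u)%:R) Xxs).2 /Rintegral; congr fine.
rewrite -(setIT (X @^-1` _)) -integral_indic//; last exact: measurable_int_preimage.
by apply: eq_integral => w _; rewrite indicE mem_setE/=.
Qed.

Lemma bounded_supported : bounded_increment X -> exists xs, supported_on xs.
Proof.
move=> [B [fB _ B0]].
have [s sB] := (finite_seqP B).1 fB.
exists (undup s); split; first exact: undup_uniq.
by move=> u; rewrite mem_undup => us; apply: B0; rewrite sB; exact/negP.
Qed.

End integer_variables.

(** * The law of the selected color *)

Section urn_law.
Context (R : realType) (p : int -> R) (xs : seq int).
Implicit Types (n : nat) (u v : int).

(** At the next draw the urn has total mass n + 2.  With weight (n + 1) / (n + 2)
    the draw is made from the old content, whose normalization is the law of the
    previous color; with weight 1 / (n + 2) it is made from the row just added,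
    which displaces the previous color by an increment. *)
Fixpoint urn_law n : seq (R * int) :=
  if n is m.+1 then
    [seq (m.+1%:R / m.+2%:R * a.1, a.2) | a <- urn_law m] ++
    [seq (p x / m.+2%:R * a.1, a.2 + x) | x <- xs, a <- urn_law m]
  else [:: (1, 0)].

(** Stated along a ring morphism so as to apply to real means and to complex
    characteristic functions. *)
Lemma urn_lawS (S : comNzRingType) (phi : {rmorphism R -> S}) (g : int -> S) n :
  \sum_(a <- urn_law n.+1) phi a.1 * g a.2 =
  phi (n.+1%:R / n.+2%:R) * (\sum_(a <- urn_law n) phi a.1 * g a.2) +
  \sum_(x <- xs) phi (p x / n.+2%:R) * (\sum_(a <- urn_law n) phi a.1 * g (a.2 + x)).
Proof.
rewrite /= big_cat big_map big_allpairs_dep/=; congr (_ + _).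
  by rewrite mulr_sumr; apply: eq_bigr => a _; rewrite rmorphM mulrA.
apply: eq_bigr => x _; rewrite mulr_sumr; apply: eq_bigr => a _.
by rewrite rmorphM mulrA.
Qed.

Lemma urn_law_realS (g : int -> R) n :
  \sum_(a <- urn_law n.+1) a.1 * g a.2 =
  n.+1%:R / n.+2%:R * (\sum_(a <- urn_law n) a.1 * g a.2) +
  \sum_(x <- xs) p x / n.+2%:R * (\sum_(a <- urn_law n) a.1 * g (a.2 + x)).
Proof. exact: (urn_lawS idfun). Qed.

Hypothesis p_ge0 : forall u, 0 <= p u.
Hypothesis p_sum1 : \sum_(u <- xs) p u = 1.

Lemma urn_law_ge0 n a : a \in urn_law n -> 0 <= a.1.
Proof.
elim: n a => [|n IHn] a; first by rewrite inE => /eqP ->.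
rewrite mem_cat => /orP[/mapP[b bL ->]|/allpairsP[[x b]/= [_ bL ->]]] /=.
  by rewrite mulr_ge0 ?IHn// divr_ge0.
by rewrite mulr_ge0 ?IHn// divr_ge0.
Qed.

Lemma urn_law_sum1 n : \sum_(a <- urn_law n) a.1 = 1.
Proof.
have E m : \sum_(a <- urn_law m) a.1 = \sum_(a <- urn_law m) a.1 * cst 1 a.2.
  by apply: eq_bigr => a _; rewrite mulr1.
elim: n => [|n IHn]; first by rewrite big_seq1.
rewrite E urn_law_realS -E IHn /=.
have F : \sum_(a <- urn_law n) a.1 * 1 = 1 by rewrite -[RHS]IHn E.
rewrite (eq_bigr (fun x => p x / n.+2%:R)); last first.
  by move=> x _; rewrite -[RHS]mulr1; congr (_ * _); exact: F.
by rewrite -mulr_suml p_sum1 mulr1 -mulrDl natr1 divff.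
Qed.

Context d (T : measurableType d) (P : probability T R).
Context (U : nat -> int -> {RV P >-> R}) (Z : nat -> {RV P >-> int}).
Hypothesis urnUZ : infinite_urn (walk_matrix p) U Z.
Hypothesis U0 : forall v w, U 0%N v w = (v == 0)%:R.
Hypothesis xs_uniq : uniq xs.
Hypothesis p_out : forall u, u \notin xs -> p u = 0.

(** Averaging the selection rule over the whole space: the mean composition of the
    urn determines the law of the selected color, without any conditioning. *)
Lemma urn_mean n v : P.-integrable [set: T] (EFin \o U n v) /\
  \int[P]_w U n v w = n.+1%:R * incr_pmf (Z n) v.
Proof.
have [_ iU /(_ setT)] := urn_select urnUZ n v.
rewrite setTI => /(_ _) IU.
have iU' : P.-integrable [set: T] (EFin \o U n v).
  have := integrable_realZ measurableT n.+1%:R iU.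
  by congr (_.-integrable _ _); apply/funext => w; rewrite /= mulrC divfK.
split=> //.
have := RintegralZr n.+1%:R^-1 measurableT iU'.
rewrite {1}/Rintegral IU; last exact: (@measurableT _ (g_sigma_algebraType _)).
by rewrite -/(incr_pmf _ _) => ->; rewrite mulrC divfK.
Qed.

Lemma urn_pmf0 v : incr_pmf (Z 0%N) v = (v == 0)%:R.
Proof.
have [_] := urn_mean 0 v; rewrite mul1r => <-.
under eq_Rintegral do rewrite U0.
by rewrite Rintegral_cst//= probability_setT mulr1.
Qed.

Lemma urn_pmfS n v : incr_pmf (Z n.+1) v =
  n.+1%:R / n.+2%:R * incr_pmf (Z n) v +
  \sum_(x <- xs) p x / n.+2%:R * incr_pmf (Z n) (v - x).
Proof.
have [_] := urn_mean n.+1 v; have [iU IU] := urn_mean n v.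
have E w : U n.+1 v w = U n v w + \sum_(x <- xs) p x * (Z n w == v - x)%:R.
  rewrite (urn_reinforce urnUZ) /walk_matrix; congr (_ + _).
  have eqZ x : (Z n w == v - x) = (x == v - Z n w).
    by rewrite eq_sym subr_eq addrC -subr_eq eq_sym.
  under eq_bigr do rewrite eqZ.
  have [vx|vx] := boolP (v - Z n w \in xs).
    rewrite (bigD1_seq (v - Z n w))//= eqxx mulr1 big1 ?addr0// => x.
    by move=> /negbTE ->; rewrite mulr0.
  rewrite (p_out vx) big_seq big1// => x xx.
  by case: eqP => [xE|]; rewrite ?mulr0//; move: vx; rewrite -xE xx.
have [ig Ig] := mean_int_indic (Z n) xs p (fun x => v - x).
under eq_Rintegral do rewrite E.
rewrite (RintegralD measurableT iU ig) IU Ig => h.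
have n2 : n.+2%:R != 0 :> R by [].
apply: (mulfI n2); rewrite -h mulrDr mulr_sumr; congr (_ + _).
  by field.
by apply: eq_bigr => x _; field.
Qed.

Lemma urn_law_pmf n v :
  incr_pmf (Z n) v = \sum_(a <- urn_law n) a.1 * (a.2 == v)%:R.
Proof.
elim: n v => [|n IHn] v.
  by rewrite urn_pmf0 big_seq1/= mul1r eq_sym.
rewrite urn_pmfS IHn (urn_law_realS (fun u => (u == v)%:R)); congr (_ + _).
apply: eq_bigr => x _; rewrite IHn; congr (_ * _); apply: eq_bigr => a _.
by rewrite eq_sym subr_eq eq_sym.
Qed.

Lemma urn_prob n (A : pred int) :
  fine (P (Z n @^-1` [set u | A u])) = \sum_(a <- urn_law n) a.1 * (A a.2)%:R.
Proof.
pose s := undup [seq a.2 | a <- urn_law n].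
have sZ : supported_on (Z n) s.
  split; first exact: undup_uniq.
  move=> u; rewrite mem_undup => us; rewrite urn_law_pmf big_seq big1// => a aL.
  case: eqP => [au|]; rewrite ?mulr0//.
  by case/negP: us; apply/mapP; exists a.
rewrite (prob_int A sZ).
under eq_bigr do rewrite urn_law_pmf mulr_suml.
rewrite exchange_big/= big_seq [RHS]big_seq; apply: eq_bigr => a aL.
have as_ : a.2 \in s by rewrite mem_undup; apply/mapP; exists a.
rewrite (bigD1_seq a.2) ?undup_uniq//= eqxx mulr1 big1 ?addr0// => u.
by rewrite eq_sym => /negbTE ->; rewrite mulr0 mul0r.
Qed.

End urn_law.

Section urn_transform.
Context (R : realType) (p : int -> R) (xs : seq int).
Implicit Types (n : nat) (t q m b : R).

Definition expi (x : R) : R[i] := Complex (cos x) (sin x).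

Lemma expi0 : expi 0 = 1.
Proof. by rewrite /expi cos0 sin0. Qed.

Lemma expiD x y : expi (x + y) = expi x * expi y.
Proof. by rewrite /expi cosD sinD; congr Complex; ring. Qed.

Lemma chfE (s : seq (R * R)) t :
  chf s t = \sum_(a <- s) a.1%:C%C * expi (t * a.2).
Proof.
rewrite /chf /lmean; elim: s => [|a s IHs]; first by rewrite !big_nil.
rewrite !big_cons -IHs /expi; congr Complex => /=; ring.
Qed.

Definition step_transform t : R[i] := \sum_(x <- xs) (p x)%:C%C * expi (t * x%:~R).

(** Mixing a law with its image under an independent increment multiplies the
    characteristic function by 1 - q + q psi(t).  So the selected color has the law
    of a sum of independent increments, each kept with probability 1 / (j + 2). *)
Lemma urn_law_transform n t :
  \sum_(a <- urn_law p xs n) a.1%:C%C * expi (t * a.2%:~R) =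
  \prod_(j < n) (1 - (j.+2%:R^-1)%:C%C + (j.+2%:R^-1)%:C%C * step_transform t).
Proof.
elim: n => [|n IHn]; first by rewrite big_seq1 big_ord0 mulr0 expi0 mulr1.
rewrite big_ord_recr/= -IHn.
rewrite (@urn_lawS _ _ _ _ (@real_complex R) (fun u => expi (t * u%:~R))) mulrDr; congr (_ + _).
  rewrite mulrC; congr (_ * _).
  have -> : n.+1%:R / n.+2%:R = 1 - n.+2%:R^-1 :> R.
    by apply/esym/eqP; rewrite subr_eq -[X in _ + X]mul1r -mulrDl natr1 divff.
  by rewrite rmorphB rmorph1.
rewrite /step_transform !mulr_sumr; apply: eq_bigr => x _.
have -> : \sum_(a <- urn_law p xs n) a.1%:C%C * expi (t * (a.2 + x)%:~R) =
    expi (t * x%:~R) * \sum_(a <- urn_law p xs n) a.1%:C%C * expi (t * a.2%:~R).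
  rewrite mulr_sumr; apply: eq_bigr => a _.
  by rewrite [RHS]mulrCA -expiD; congr (_ * expi _); rewrite rmorphD/=; ring.
by rewrite rmorphM/=; ring.
Qed.

Definition urn_std n m b : seq (R * R) :=
  [seq (a.1, (a.2%:~R - m) / b) | a <- urn_law p xs n].

(** The law of a centered and scaled increment that is kept with probability q and
    replaced by 0 otherwise. *)
Definition step_std q m b : seq (R * R) :=
  (1 - q, (0 - m * q) / b) :: [seq (q * p x, (x%:~R - m * q) / b) | x <- xs].

Lemma chf_urn_std n m b t : chf (urn_std n m b) t =
  expi (- (t * m / b)) * \sum_(a <- urn_law p xs n) a.1%:C%C * expi (t / b * a.2%:~R).
Proof.
rewrite chfE big_map mulr_sumr; apply: eq_bigr => a _ /=.
by rewrite [RHS]mulrCA -expiD; congr (_ * expi _); ring.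
Qed.

Lemma chf_step_std q m b t : chf (step_std q m b) t =
  expi (- (t * (m * q) / b)) * (1 - q%:C%C + q%:C%C * step_transform (t / b)).
Proof.
rewrite chfE big_cons big_map /= mulrDr; congr (_ + _).
  rewrite mulrC; congr (expi _ * _); first by ring.
  by rewrite rmorphB.
rewrite /step_transform !mulr_sumr; apply: eq_bigr => x _.
have -> : t * ((x%:~R - m * q) / b) = - (t * (m * q) / b) + t / b * x%:~R by ring.
by rewrite expiD rmorphM/=; ring.
Qed.

End urn_transform.

(** * Normal approximation for the urn *)

Section urn_normal_approximation.
Context (R : realType) (p : int -> R) (xs : seq int).
Hypothesis p_ge0 : forall u, 0 <= p u.
Hypothesis p_sum1 : \sum_(u <- xs) p u = 1.
Implicit Types (n : nat) (q b x : R) (f : R -> R).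

Let m : R := \sum_(x <- xs) p x * x%:~R.
Let m2 : R := \sum_(x <- xs) p x * x%:~R ^+ 2.
Let m3 q : R := \sum_(x <- xs) p x * `|x%:~R - m * q| ^+ 3.
Let r j : R := j.+2%:R^-1.

Lemma lmean_step_std q b f : lmean (step_std p xs q m b) f =
  (1 - q) * f ((0 - m * q) / b) + q * \sum_(x <- xs) p x * f ((x%:~R - m * q) / b).
Proof.
rewrite /lmean big_cons big_map mulr_sumr; congr (_ + _).
by apply: eq_bigr => x _; rewrite mulrA.
Qed.

Lemma step_std_law q b : 0 <= q <= 1 -> is_law (step_std p xs q m b).
Proof.
move=> /andP[q0 q1]; split.
  move=> a; rewrite inE => /orP[/eqP ->/=|/mapP[x _ ->]/=]; first by rewrite subr_ge0.
  by rewrite mulr_ge0.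
rewrite lmean_step_std (eq_bigr p) => [|x _]; last by rewrite mulr1.
by rewrite p_sum1 !mulr1 subrK.
Qed.

Lemma step_std_centered q b : centered (step_std p xs q m b).
Proof.
rewrite /centered lmean_step_std /=.
have -> : \sum_(x <- xs) p x * ((x%:~R - m * q) / b) = (m - m * q) / b.
  rewrite (eq_bigr (fun x : int => (p x * x%:~R - p x * (m * q)) / b)) => [|x _]; last by ring.
  by rewrite -mulr_suml sumrB -[X in _ - X]mulr_suml p_sum1 mul1r.
ring.
Qed.

Lemma step_std_mom2 q b :
  mom2 (step_std p xs q m b) = (q * m2 - m ^+ 2 * q ^+ 2) / b ^+ 2.
Proof.
rewrite /mom2 lmean_step_std.
have -> : \sum_(x <- xs) p x * ((x%:~R - m * q) / b) ^+ 2 =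
   (m2 - 2 * m * (m * q) + (m * q) ^+ 2) / b ^+ 2.
  rewrite (eq_bigr (fun x : int => (p x * x%:~R ^+ 2 - 2 * (m * q) * (p x * x%:~R)
     + p x * (m * q) ^+ 2) / b ^+ 2)) => [|x _]; last by rewrite -exprVn; ring.
  rewrite -mulr_suml big_split/= sumrB -[X in _ - X]mulr_sumr -[X in _ + X]mulr_suml p_sum1.
  by rewrite mul1r -/m -/m2; congr (_ / _); ring.
by rewrite -exprVn; ring.
Qed.

Lemma step_std_mom3 q b : 0 <= q <= 1 -> 0 < b -> mom3 (step_std p xs q m b) =
  (q * m3 q + `|m| ^+ 3 * ((1 - q) * q ^+ 3)) / b ^+ 3.
Proof.
move=> /andP[q0 q1] b0; rewrite /mom3 lmean_step_std.
have nb z : `|z / b| ^+ 3 = `|z| ^+ 3 / b ^+ 3.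
  by rewrite normrM exprMn [`|b^-1|]ger0_norm ?exprVn// invr_ge0 ltW.
rewrite nb sub0r normrN normrM [`|q|]ger0_norm//.
have -> : \sum_(x <- xs) p x * `|(x%:~R - m * q) / b| ^+ 3 = m3 q / b ^+ 3.
  by rewrite /m3 mulr_suml; apply: eq_bigr => x _; rewrite nb mulrA.
by rewrite exprMn; ring.
Qed.

Lemma urn_std_law n c b : is_law (urn_std p xs n c b).
Proof.
split.
  by move=> _ /mapP[a aL ->] /=; exact: (urn_law_ge0 p_ge0 aL).
rewrite /lmean big_map -[RHS](urn_law_sum1 p_sum1 n).
by apply: eq_bigr => a _; rewrite mulr1.
Qed.

(** By [urn_law_transform] the standardized color has the characteristic function
    of a sum of independent variables with laws [step_std], whose variances and
    third absolute moments are those in the statement. *)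
Theorem urn_berry_esseen n b x : 0 < b ->
  b ^+ 2 = \sum_(j < n) (r j * m2 - m ^+ 2 * r j ^+ 2) ->
  `|\sum_(a <- urn_law p xs n) a.1 * ((a.2%:~R - m * \sum_(j < n) r j) / b <= x)%R%:R
    - normal_cdf x| <=
  275 / 100 * ((\sum_(j < n) (r j * m3 (r j) + `|m| ^+ 3 * ((1 - r j) * r j ^+ 3))) / b ^+ 3).
Proof.
move=> b0 bE; set h := \sum_(j < n) r j.
have r01 j : 0 <= r j <= 1.
  by rewrite invr_ge0 ler0n invf_le1// ler1n.
have -> : \sum_(a <- urn_law p xs n) a.1 * ((a.2%:~R - m * h) / b <= x)%R%:R =
    lmean (urn_std p xs n (m * h) b) (fun v => (v <= x)%R%:R).
  by rewrite /lmean big_map.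
have M3 : \sum_(j < n) mom3 (step_std p xs (r j) m b) =
    (\sum_(j < n) (r j * m3 (r j) + `|m| ^+ 3 * ((1 - r j) * r j ^+ 3))) / b ^+ 3.
  by rewrite mulr_suml; apply: eq_bigr => j _; rewrite step_std_mom3.
rewrite -M3; apply: (@berry_esseen _ (fun j => step_std p xs (r j) m b)).
- by move=> j _; exact: step_std_law.
- by move=> j _; exact: step_std_centered.
- rewrite (eq_bigr (fun j : 'I_n => (r j * m2 - m ^+ 2 * r j ^+ 2) / b ^+ 2)).
    by rewrite -mulr_suml -bE divff// expf_neq0// lt0r_neq0.
  by move=> j _; exact: step_std_mom2.
- exact: urn_std_law.
move=> t; rewrite chf_urn_std urn_law_transform.
under [RHS]eq_bigr do rewrite chf_step_std.
rewrite big_split /=; congr (_ * _).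
rewrite /h; elim: (n) => [|k IHk]; first by rewrite !big_ord0 mulr0 mulr0 mul0r oppr0 expi0.
by rewrite !big_ord_recr/= -IHk -expiD; congr expi; ring.
Qed.

End urn_normal_approximation.

(** * The Lyapunov ratio and its order of magnitude *)

Section normalization.
Context (R : realType) d (T : measurableType d) (Q : probability T R).
Context (X : {RV Q >-> int}) (xs : seq int).
Hypothesis Xxs : supported_on X xs.
Implicit Types (n j : nat).

Let p := incr_pmf X.
Let m : R := \sum_(x <- xs) p x * x%:~R.
Let m2 : R := \sum_(x <- xs) p x * x%:~R ^+ 2.
Let m3 q : R := \sum_(x <- xs) p x * `|x%:~R - m * q| ^+ 3.
Let r j : R := j.+2%:R^-1.

Let p_ge0 u : 0 <= p u. Proof. exact: incr_pmf_ge0. Qed.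
Let p_sum1 : \sum_(x <- xs) p x = 1. Proof. exact: incr_pmf_sum1. Qed.

Lemma incr_meanE : incr_mean X = m.
Proof. by rewrite /incr_mean (expectation_int (fun u => u%:~R) Xxs). Qed.

Lemma incr_moment2E : incr_moment2 X = m2.
Proof. by rewrite /incr_moment2 (expectation_int (fun u => u%:~R ^+ 2) Xxs). Qed.

Lemma harmE n : harm R n = \sum_(j < n) r j.
Proof. by rewrite /harm big_add1 big_mkord. Qed.

Lemma scaled_rho2 n : (1 <= n)%N ->
  n%:R * rho2 X n = \sum_(j < n) (r j * m2 - m ^+ 2 * r j ^+ 2).
Proof.
move=> n1; rewrite /rho2 mulVKf; last by rewrite pnatr_eq0 -lt0n.
rewrite harmE incr_moment2E incr_meanE big_add1 big_mkord sumrB !mulr_sumr.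
by congr (_ - _); apply: eq_bigr => j _; rewrite ?exprVn// mulrC.
Qed.

Lemma scaled_rho3 n : (1 <= n)%N -> n%:R * rho3 X n =
  \sum_(j < n) (r j * m3 (r j) + `|m| ^+ 3 * ((1 - r j) * r j ^+ 3)).
Proof.
move=> n1; rewrite /rho3 mulVKf; last by rewrite pnatr_eq0 -lt0n.
rewrite incr_meanE !big_add1 !big_mkord big_split mulr_sumr /=.
congr (_ + _); apply: eq_bigr => j _.
  by rewrite (expectation_int (fun u => `|u%:~R - m / j.+2%:R| ^+ 3) Xxs).
congr (_ * _); rewrite /r.
have -> : 1 - j.+2%:R^-1 = j.+1%:R / j.+2%:R :> R.
  by apply/eqP; rewrite subr_eq -[X in _ + X]mul1r -mulrDl natr1 divff.
by rewrite exprS invfM exprVn mulrA.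
Qed.

Lemma sqr_mean_le : m ^+ 2 <= m2.
Proof.
rewrite -subr_ge0; have -> : m2 - m ^+ 2 = \sum_(x <- xs) p x * (x%:~R - m) ^+ 2.
  apply/esym; rewrite (eq_bigr (fun x : int => p x * x%:~R ^+ 2 - 2 * m * (p x * x%:~R)
     + p x * m ^+ 2)) => [|x _]; last by ring.
  rewrite big_split/= sumrB -[X in _ - X + _ = _]mulr_sumr -[X in _ + X = _]mulr_suml p_sum1.
  by rewrite mul1r -/m -/m2; ring.
by apply: sumr_ge0 => x _; rewrite mulr_ge0// sqr_ge0.
Qed.

(** A vanishing second moment leaves 0 as the only possible value. *)
Lemma moment2_gt0 : ~ {ae Q, forall w, X w = 0} -> 0 < m2.
Proof.
move=> X0; rewrite lt0r; apply/andP; split; last first.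
  by apply: sumr_ge0 => x _; rewrite mulr_ge0// sqr_ge0.
apply/eqP => m20; apply: X0.
have p0 u : u != 0 -> p u = 0.
  move=> u0; case: (boolP (u \in xs)) => [uxs|]; last exact: Xxs.2.
  have := m20; rewrite /m2 => /eqP; rewrite psumr_eq0; last first.
    by move=> x _; rewrite mulr_ge0// sqr_ge0.
  by move/allP => /(_ _ uxs) /=; rewrite mulf_eq0 expf_eq0/= intr_eq0 (negbTE u0) orbF => /eqP.
have X0 : supported_on X [:: 0%R].
  by split => // u; rewrite inE => /p0.
by apply: filterS (supported_ae X0) => w; rewrite inE => /eqP.
Qed.

Lemma rj_itv j : 0 < r j <= 2^-1.
Proof. by rewrite invr_gt0 ltr0n/= lef_pV2 ?posrE ?ltr0n// ler_nat. Qed.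

(** Since m^2 <= m2 and q <= 1/2, the subtracted term m^2 q^2 is at most half of
    q m2. *)
Lemma scaled_rho2_ge n : (1 <= n)%N -> m2 / 2 * harm R n <= n%:R * rho2 X n.
Proof.
move=> n1; rewrite scaled_rho2// harmE mulr_sumr; apply: ler_sum => j _.
have /andP[r0 r1] := rj_itv j; have := sqr_mean_le; have := sqr_ge0 m.
move: (m ^+ 2) m2 (r j) r0 r1 => a c q q0 q1 a0 ac.
have : q * (a * q) <= q * (c * 2^-1) by rewrite ler_pM2l// ler_pM// ltW.
rewrite (_ : q * (a * q) = a * q ^+ 2); [lra | ring].
Qed.

Lemma scaled_rho3_le n : (1 <= n)%N -> n%:R * rho3 X n <=
  (\sum_(x <- xs) p x * (`|x%:~R| + `|m|) ^+ 3 + `|m| ^+ 3) * harm R n.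
Proof.
move=> n1; rewrite scaled_rho3// harmE mulr_sumr; apply: ler_sum => j _.
have /andP[r0 r1] := rj_itv j.
rewrite [leRHS]mulrDl; apply: lerD.
  rewrite mulrC ler_pM2r//; apply: ler_sum => x _; apply: ler_wpM2l => //.
  apply: lerXn2r; rewrite ?nnegrE ?addr_ge0//.
  apply: (le_trans (ler_normB _ _)); rewrite lerD2l normrM ler_piMr//.
  by rewrite ger0_norm; [lra | exact: ltW].
apply: ler_wpM2l; first by rewrite exprn_ge0.
rewrite exprS mulrCA ler_piMr//; first exact: ltW.
by rewrite mulr_ile1// ?exprn_ge0 ?exprn_ile1//; lra.
Qed.

Lemma scaled_rho3_ge0 n : (1 <= n)%N -> 0 <= n%:R * rho3 X n.
Proof.
move=> n1; rewrite scaled_rho3//; apply: sumr_ge0 => j _.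
have /andP[r0 r1] := rj_itv j.
have s0 : 0 <= 1 - r j by lra.
rewrite addr_ge0// mulr_ge0 ?(ltW r0)// ?exprn_ge0//; last first.
  by rewrite mulr_ge0// exprn_ge0// ltW.
by apply: sumr_ge0 => x _; rewrite mulr_ge0// exprn_ge0.
Qed.

Lemma lyapunov_ratioE n : (1 <= n)%N -> 0 < rho2 X n ->
  rho3 X n / (Num.sqrt n%:R * rho2 X n `^ (3 / 2)) =
  n%:R * rho3 X n / Num.sqrt (n%:R * rho2 X n) ^+ 3.
Proof.
move=> n1 p2; have n0 : 0 < n%:R :> R by rewrite ltr0n.
rewrite [3 / 2]mulrC powRrM powR12_sqrt ?ltW// powR_mulrn ?sqrtr_ge0//.
rewrite (sqrtrM (rho2 X n) (ltW n0)) exprMn.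
set s := Num.sqrt n%:R; have s0 : 0 < s by rewrite sqrtr_gt0.
set t := Num.sqrt (rho2 X n); have t0 : 0 < t by rewrite sqrtr_gt0.
have -> : n%:R = s ^+ 2 by rewrite sqr_sqrtr// ltW.
by field; rewrite !lt0r_neq0.
Qed.

End normalization.

Lemma harm_ge_half (R : realType) n : (1 <= n)%N -> 2^-1 <= harm R n.
Proof.
case: n => // n _; rewrite harmE big_ord_recl /= lerDl.
by apply: sumr_ge0 => i _; rewrite invr_ge0.
Qed.

(** Induction on ln (1 + 1/k) <= 1/k. *)
Lemma ln_le_harm (R : realType) n : ln n.+2%:R <= 1 + harm R n.
Proof.
elim: n => [|n IHn].
  by rewrite harmE big_ord0 addr0; rewrite -[2%:R]/(1 + 1 : R) le_ln1Dx//; lra.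
rewrite harmE big_ord_recr/= addrA -harmE; apply: le_trans (lerD IHn (lexx _)).
have n0 : 0 < n.+2%:R :> R by rewrite ltr0n.
have -> : n.+3%:R = n.+2%:R * (1 + n.+2%:R^-1) :> R.
  by rewrite mulrDr mulr1 divff ?lt0r_neq0// natr1.
have v0 : 0 < n.+2%:R^-1 :> R by rewrite invr_gt0.
rewrite lnM ?posrE ?addr_gt0//.
by rewrite lerD2l le_ln1Dx//; apply: lt_trans v0; lra.
Qed.

Lemma ln_le_3harm (R : realType) n : (1 <= n)%N -> ln (n%:R : R) <= 3 * harm R n.
Proof.
move=> n1; have h2 := harm_ge_half R n1; have l := ln_le_harm R n.
have : ln (n%:R : R) <= ln n.+2%:R.
  by rewrite ler_ln ?posrE ?ltr0n// ler_nat -addn2 leq_addr.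
lra.
Qed.

Theorem theorem1 (R : realType)
    (dX : measure_display) (TX : measurableType dX) (Q : probability TX R)
    (X : nat -> {RV Q >-> int})
    (X_iid : iid [set j | (1 <= j)%N] X)
    (X_bounded : bounded_increment (X 1%N))
    (X_nontrivial : ~ {ae Q, forall w, X 1%N w = 0})
    (d : measure_display) (T : measurableType d) (P : probability T R)
    (U : nat -> int -> {RV P >-> R}) (Z : nat -> {RV P >-> int})
    (urnUZ : infinite_urn (walk_matrix (incr_pmf (X 1%N))) U Z)
    (U0 : forall v w, U 0%N v w = (v == 0)%:R) :
  (forall n : nat, (1 <= n)%N ->
    (ereal_sup (range (fun x : R =>
        `| fine (P [set w | ((Z n w)%:~R - incr_mean (X 1%N) * harm R n)
                            / Num.sqrt (n%:R * rho2 (X 1%N) n) <= x])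
           - normal_cdf x |%:E))
     <= (275%:R / 100%:R *
          (rho3 (X 1%N) n
            / (Num.sqrt n%:R * rho2 (X 1%N) n `^ (3%:R / 2%:R))))%:E)%E)
  /\
  ((fun n : nat => rho3 (X 1%N) n
      / (Num.sqrt n%:R * rho2 (X 1%N) n `^ (3%:R / 2%:R)))
   =O_\oo (fun n : nat => 1 / Num.sqrt (ln (n%:R : R)))).
Proof.
have [xs Xxs] := bounded_supported X_bounded.
set p := incr_pmf (X 1%N) in urnUZ *.
have p0 u : 0 <= p u := incr_pmf_ge0 (X 1%N) u.
have p1 : \sum_(u <- xs) p u = 1 := incr_pmf_sum1 Xxs.
have m2_gt0 := moment2_gt0 Xxs X_nontrivial.
have V_gt0 n : (1 <= n)%N -> 0 < n%:R * rho2 (X 1%N) n.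
  move=> n1; apply: lt_le_trans (scaled_rho2_ge Xxs n1).
  by rewrite mulr_gt0 ?divr_gt0// (lt_le_trans _ (harm_ge_half R n1))// invr_gt0.
have rho2_gt0 n : (1 <= n)%N -> 0 < rho2 (X 1%N) n.
  by move=> n1; have := V_gt0 _ n1; rewrite pmulr_rgt0// ltr0n.
split=> [n n1|].
  apply: ub_ereal_sup => _ [x _ <-]; rewrite lee_fin.
  rewrite (lyapunov_ratioE n1 (rho2_gt0 _ n1)).
  have := @urn_prob R p xs d T P U Z urnUZ U0 Xxs.1 Xxs.2 n.
  move=> /(_ (fun u => (u%:~R - incr_mean (X 1%N) * harm R n)
      / Num.sqrt (n%:R * rho2 (X 1%N) n) <= x)) ->.
  rewrite (incr_meanE Xxs) (harmE R n) (scaled_rho3 Xxs n1).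
  apply: urn_berry_esseen => //; first by rewrite sqrtr_gt0 V_gt0.
  by rewrite sqr_sqrtr ?ltW ?V_gt0// (scaled_rho2 Xxs n1).
apply/eqO_exP => /=.
set m2 := \sum_(x <- xs) _ in m2_gt0.
pose C : R := \sum_(x <- xs) p x * (`|x%:~R| + `|\sum_(x <- xs) p x * x%:~R|) ^+ 3
  + `|\sum_(x <- xs) p x * x%:~R| ^+ 3.
have C0 : 0 <= C.
  rewrite addr_ge0 ?exprn_ge0//; apply: sumr_ge0 => x _.
  by rewrite mulr_ge0// exprn_ge0// addr_ge0.
pose s := Num.sqrt (m2 / 6).
have s0 : 0 < s by rewrite sqrtr_gt0 divr_gt0.
exists (2 * C / m2 / s + 1).
  by rewrite ltr_wpDl// !mulr_ge0 ?invr_ge0// ltW.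
near=> n.
have n2 : (2 <= n)%N by near: n; exact: nbhs_infty_ge.
have n1 : (1 <= n)%N by exact: ltnW.
have l0 : 0 < ln (n%:R : R) by rewrite ln_gt0// ltr1n.
have h0 : 0 < harm R n by rewrite (lt_le_trans _ (harm_ge_half R n1))// invr_gt0.
have V0 := V_gt0 _ n1; set V := n%:R * rho2 _ n in V0.
have b0 : 0 < Num.sqrt V by rewrite sqrtr_gt0.
have sb : s * Num.sqrt (ln n%:R) <= Num.sqrt V.
  have m60 : 0 <= m2 / 6 by rewrite divr_ge0// ltW.
  rewrite /s -(sqrtrM (ln n%:R) m60) ler_sqrt; last exact: ltW.
  apply: le_trans (scaled_rho2_ge Xxs n1).
  have -> : m2 / 2 * harm R n = m2 / 6 * (3 * harm R n) by field.
  by apply: ler_wpM2l (ln_le_3harm R n1).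
rewrite (lyapunov_ratioE n1 (rho2_gt0 _ n1)) -/V.
have bV : Num.sqrt V ^+ 2 = V by rewrite sqr_sqrtr// ltW.
have Vh : m2 / 2 * harm R n <= V := scaled_rho2_ge Xxs n1.
have NC : n%:R * rho3 (X 1%N) n <= C * harm R n := scaled_rho3_le Xxs n1.
have N0 := scaled_rho3_ge0 Xxs n1.
have L0 : 0 < Num.sqrt (ln (n%:R : R)) by rewrite sqrtr_gt0.
move: (Num.sqrt (ln n%:R)) (Num.sqrt V) (n%:R * rho3 _ _) (harm R n)
  L0 b0 sb bV Vh NC N0 h0 => L b N h L0 b0 sb bV Vh NC N0 h0.
rewrite [X in X <= _]ger0_norm; last by rewrite divr_ge0// exprn_ge0// ltW.
rewrite ger0_norm; last by rewrite divr_ge0// ltW.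
have NV : N <= 2 * C / m2 * b ^+ 2.
  rewrite bV; apply: (le_trans NC).
  have -> : C * h = 2 * C / m2 * (m2 / 2 * h) by field; rewrite lt0r_neq0.
  by apply: ler_wpM2l Vh; rewrite !mulr_ge0// invr_ge0 ltW.
apply: (@le_trans _ _ (2 * C / m2 / (s * L))).
  rewrite ler_pdivrMr ?exprn_gt0// (le_trans NV)//.
  rewrite -[leRHS]mulrA; apply: ler_wpM2l; first by rewrite !mulr_ge0// invr_ge0 ltW.
  by rewrite ler_pdivlMl ?mulr_gt0// [b ^+ 3]exprS ler_pM2r// exprn_gt0.
rewrite invfM [leLHS]mulrA mul1r [leRHS]mulrDl mul1r lerDl invr_ge0; exact: ltW.
Unshelve. all: by end_near. Qed.
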